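(* Let $M$ be a connected Riemannian 2-manifold and let $f: M\to \mathbb{S}^3=SU(2)$ be an isometric immersion with unit normal vector field $n$, whose Gauss curvature $K$ satisfies $K<1$. Then the normal Gauss map $\nu=f^{-1}n: M\to \mathbb{S}^2\subset\mathfrak{su}(2)$ is Lorentz harmonic with respect to the conformal structure on $M$ determined by the second fundamental form $\mathrm{II}$ of $f$ if and only if $K$ is constant.
   Context: The unit sphere $\mathbb{S}^3\subset\mathbb{R}^4=\mathbb{C}^2$ is identified with $SU(2)$ via $(z,w)\mapsto \begin{pmatrix} z & w\\ -\bar w & \bar z\end{pmatrix}$. Its standard metric (constant curvature $1$) is $g(V,W)=\langle x^{-1}V,x^{-1}W\rangle$ for $V,W\in T_x SU(2)$, where $\langle X,Y\rangle=-\frac12\mathrm{Tr}(XY)$ on $\mathfrak{su}(2)$. $\mathbb{S}^2$ denotes the unit sphere in the Euclidean 3-space $(\mathfrak{su}(2),\langle\cdot,\cdot\rangle)$. For an immersion $f:M\to SU(2)$ with unit normal $n$, the normal Gauss map is $\nu=f^{-1}n$ (left translation of $n$ to $\mathfrak{su}(2)$). $K$ is the Gauss (intrinsic) curvature of the first fundamental form $\mathrm{I}$. When $K<1$, the second fundamental form $\mathrm{II}$ derived from $n$ is a Lorentzian metric on $M$. Asymptotic coordinates are local coordinates $(u,v)$ in which the $du^2$ and $dv^2$ coefficients of $\mathrm{II}$ vanish; they are conformal (null) coordinates for the Lorentz conformal structure determined by $\mathrm{II}$. A smooth map $\nu:M\to\mathbb{S}^2$ from a Lorentz surface is Lorentz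 harmonic (a wave map) if its tension field with respect to any Lorentzian metric in the conformal class vanishes. Equivalently, for any such local null coordinates $(u,v)$ there is a function $k$ such that $\nu_{uv}=k\,\nu$. *)

(* Defs.v *)
From mathcomp Require Import all_boot all_order all_algebra sesquilinear spectral.
From mathcomp Require Import all_classical all_reals all_analysis.
From mathcomp Require Import complex.
Import Order.TTheory GRing.Theory Num.Theory numFieldNormedType.Exports.

Set Implicit Arguments.
Unset Strict Implicit.
Unset Printing Implicit Defensive.

Local Open Scope classical_set_scope.
Local Open Scope ring_scope.
Local Open Scope complex_scope.
Local Open Scope sesquilinear_scope.

Definition pd (R : realType) (V : normedModType R) (k : 'I_2)
    (F : 'rV[R]_2 -> V) : 'rV[R]_2 -> V :=
  'D_(delta_mx 0 k) F.

Fixpoint Ck_on (R : realType) (V : normedModType R) (m : nat)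
    (U : set 'rV[R]_2) (F : 'rV[R]_2 -> V) : Prop :=
  match m with
  | 0 => forall x, U x -> {for x, continuous F}
  | m'.+1 => (forall x, U x -> differentiable F x) /\
             (forall k, Ck_on m' U (pd k F))
  end.

Definition smooth_on (R : realType) (V : normedModType R)
    (U : set 'rV[R]_2) (F : 'rV[R]_2 -> V) : Prop :=
  forall m, Ck_on m U F.

(* ['M[R[i]]_2] is a normed module over [R[i]] but not over [R] in the
   library, so maps of two real variables into it are differentiated entrywise,
   real and imaginary parts separately. *)
Definition smooth_mx_on (R : realType) (U : set 'rV[R]_2)
    (F : 'rV[R]_2 -> 'M[R[i]]_2) : Prop :=
  forall a b, smooth_on U (fun x => complex.Re (F x a b) : R) /\
              smooth_on U (fun x => complex.Im (F x a b) : R).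

Definition pd_mx (R : realType) (k : 'I_2) (F : 'rV[R]_2 -> 'M[R[i]]_2)
    (x : 'rV[R]_2) : 'M[R[i]]_2 :=
  \matrix_(a, b) (pd k (fun y => complex.Re (F y a b) : R) x
                  +i* pd k (fun y => complex.Im (F y a b) : R) x).

(* A smooth structure is given by an indexed atlas (not required maximal):
   [coord i] restricts to a homeomorphism from the open set [dom i] onto an
   open subset of the plane, with inverse [param i]; both are total functions
   whose values elsewhere are irrelevant. *)
Record surface (R : realType) := Surface {
  points :> topologicalType;
  points_hausdorff : hausdorff_space points;
  points_second_countable : @second_countable points;
  chart : Type;
  dom : chart -> set points;
  coord : chart -> points -> 'rV[R]_2;
  param : chart -> 'rV[R]_2 -> points;
  chart_at : points -> chart;
  dom_chart_at : forall p, dom (chart_at p) p;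
  dom_open : forall i, open (dom i);
  img_open : forall i, open (coord i @` dom i);
  coordK : forall i, {in dom i, cancel (coord i) (param i)};
  coord_continuous : forall i, {within dom i, continuous (coord i)};
  param_continuous : forall i, {within coord i @` dom i, continuous (param i)};
  transition_smooth : forall i j,
    smooth_on (coord i @` (dom i `&` dom j)) (coord j \o param i)
}.

Section Surface.
Variables (R : realType) (M : surface R).
Implicit Types (i j : chart M) (p : M).

Definition smooth (V : normedModType R) (F : M -> V) : Prop :=
  forall i, smooth_on (coord i @` dom i) (F \o param i).

Definition smooth_mx (F : M -> 'M[R[i]]_2) : Prop :=
  forall i, smooth_mx_on (coord i @` dom i) (F \o param i).

Definition d_mx i (k : 'I_2) (F : M -> 'M[R[i]]_2) p : 'M[R[i]]_2 :=
  pd_mx k (F \o param i) (coord i p).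

Definition dd_mx i (k l : 'I_2) (F : M -> 'M[R[i]]_2) p : 'M[R[i]]_2 :=
  pd_mx k (pd_mx l (F \o param i)) (coord i p).

(* A covariant 2-tensor field, as the family of its coefficient matrices:
   [h i p k l] is the coefficient of [dx^k (x) dx^l] at [p] in the chart [i],
   meaningful only when [p] lies in [dom i]. *)
Definition tensor2 := chart M -> M -> 'M[R]_2.
Implicit Types h g : tensor2.

(* With the row-vector convention, entry (k, l) of the Jacobian is the partial
   derivative of the l-th component along the k-th coordinate. *)
Definition smooth_sym_tensor h : Prop :=
  [/\ forall i k l,
        smooth_on (coord i @` dom i) (fun x => h i (param i x) k l : R),
      forall i p, dom i p -> (h i p)^T = h i p
    & forall i j p, dom i p -> dom j p ->
        let J := jacobian (coord j \o param i) (coord i p) in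
        h i p = J *m h j p *m J^T].

Definition riemannian_metric h : Prop :=
  smooth_sym_tensor h /\
  forall i p, dom i p ->
    forall v : 'rV[R]_2, v != 0 -> 0 < (v *m h i p *m v^T) 0 0.

(* Signature (1, 1): there is a basis, the rows of [B], in which the form is
   diag(1, -1). *)
Definition lorentzian_metric h : Prop :=
  smooth_sym_tensor h /\
  forall i p, dom i p ->
    exists2 B : 'M[R]_2, B \in unitmx &
      B *m h i p *m B^T = diag_mx (\row_k (-1) ^+ k).

Definition conformal h g : Prop :=
  exists2 lam : M -> R, smooth lam &
    forall p, 0 < lam p /\ forall i, dom i p -> h i p = lam p *: g i p.

(* [christoffel h i k l m] is the symbol Gamma^m_(kl) as a function of the
   coordinates of the chart [i]. *)
Definition christoffel h i (k l m : 'I_2) (x : 'rV[R]_2) : R :=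
  let H a b y : R := h i (param i y) a b in
  2^-1 * \sum_(s < 2) (invmx (h i (param i x))) m s *
    (pd k (H l s) x + pd l (H k s) x - pd s (H k l) x).

(* The m-th component of R(d_k, d_l) d_r, where
   R(X, Y) Z = nabla_X nabla_Y Z - nabla_Y nabla_X Z - nabla_[X, Y] Z. *)
Definition riemann h i (k l r m : 'I_2) (x : 'rV[R]_2) : R :=
  pd k (christoffel h i l r m) x - pd l (christoffel h i k r m) x
  + \sum_(s < 2) (christoffel h i l r s x * christoffel h i k s m x
                - christoffel h i k r s x * christoffel h i l s m x).

(* h(R(d_0, d_1) d_1, d_0) / det h; the value does not depend on the chart. *)
Definition gauss_curvature h p : R :=
  let i := chart_at p in
  (\sum_(m < 2) riemann h i 0 1 1 m (coord i p) * h i p m 0) / \det (h i p).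

End Surface.

Section SU2.
Variable R : realType.
Implicit Types x X Y V W : 'M[R[i]]_2.

Definition SU2 x : Prop := x \is unitarymx /\ \det x = 1.

Definition su2 X : Prop := X ^t* = - X /\ \tr X = 0.

(* The trace is real for X, Y in su(2). *)
Definition dot_su2 X Y : R := - (2^-1 * complex.Re (\tr (X *m Y))).

Definition metric_SU2 x V W : R := dot_su2 (invmx x *m V) (invmx x *m W).

(* Orthogonal projection of R^4 onto the tangent space at [x] of the sphere.
   Here R^4 is the space of matrices ((z, w), (-w^*, z^* )), whose Euclidean
   inner product is <x, W> = Re tr(x^t* W) / 2. *)
Definition proj_SU2 x W : 'M[R[i]]_2 :=
  W - (2^-1 * complex.Re (\tr (x ^t* *m W)))%:C *: x.

(* Orthogonal projection of su(2) onto the tangent space at [X] of its unit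
   sphere. *)
Definition proj_S2 X W : 'M[R[i]]_2 := W - (dot_su2 W X)%:C *: X.

End SU2.

Section Immersion.
Variables (R : realType) (M : surface R).
Implicit Types (i : chart M) (p : M) (f n nu : M -> 'M[R[i]]_2) (g h : tensor2 M).

(* For [g] a Riemannian metric the last condition forces [f] to be an
   immersion. *)
Definition isometric_immersion g f : Prop :=
  [/\ smooth_mx f, forall p, SU2 (f p)
    & forall i p, dom i p -> forall k l,
        metric_SU2 (f p) (d_mx i k f p) (d_mx i l f p) = g i p k l].

Definition unit_normal f n : Prop :=
  [/\ smooth_mx n,
      forall p, su2 (invmx (f p) *m n p),
      forall p, metric_SU2 (f p) (n p) (n p) = 1
    & forall i p, dom i p -> forall k, metric_SU2 (f p) (d_mx i k f p) (n p) = 0].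

(* II(d_k, d_l) = g(nabla_(d_k) df(d_l), n), the Levi-Civita connection of the
   sphere being the tangential part of the derivative in R^4. *)
Definition second_form f n : tensor2 M := fun i p =>
  \matrix_(k, l) metric_SU2 (f p) (proj_SU2 (f p) (dd_mx i k l f p)) (n p).

Definition normal_gauss_map f n : M -> 'M[R[i]]_2 :=
  fun p => invmx (f p) *m n p.

(* Trace with respect to [h] of the second fundamental form nabla d nu of
   [nu : M -> S^2], the Levi-Civita connection of S^2 being the tangential part
   of the derivative in su(2). *)
Definition tension h nu i p : 'M[R[i]]_2 :=
  \sum_(k < 2) \sum_(l < 2) ((invmx (h i p)) k l)%:C *:
    proj_S2 (nu p)
      (dd_mx i k l nu p
       - \sum_(m < 2) (christoffel h i k l m (coord i p))%:C *: d_mx i m nu p).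

Definition lorentz_harmonic (II : tensor2 M) nu : Prop :=
  forall h, lorentzian_metric h -> conformal h II ->
    forall i p, dom i p -> tension h nu i p = 0.

End Immersion.

(* Main.v *)
Require Import Defs.
From mathcomp Require Import all_boot all_order all_algebra.
From mathcomp Require Import all_classical all_reals all_analysis complex.
From mathcomp Require Import ring lra.
Import Order.TTheory GRing.Theory Num.Theory numFieldNormedType.Exports.
Local Open Scope classical_set_scope.
Local Open Scope ring_scope.
Set Implicit Arguments.
Unset Strict Implicit.
Unset Printing Implicit Defensive.

(** Work in a chart and put everything into su(2), that is R^3, by left translation:
    A_k = f^-1 f_k, nu = f^-1 n and B_k = f^-1 n_k.  All A_k and B_k are orthogonal
    to the unit vector nu, and nu_k = B_k - A_k x nu.  The only facts about f that
    matter are g_kl = <A_k, A_l>, II_kl = - <A_k, B_l> and the Maurer-Cartan equation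
    d_0 A_1 - d_1 A_0 = - 2 A_0 x A_1; they make the triple (A_0, A_1, nu) a
    [moving_frame].  Let s = [A_0, A_1, nu] be the area element, so that s^2 = det g,
    and let kappa = det II / det g = [B_0, B_1, nu] / s.

    The Levi-Civita connection of g is the tangential part of the derivative of the
    frame ([christ_frame]), and this gives [nu_0, nu_1, nu] = K s, hence the Gauss
    equation K = 1 + kappa ([gauss_equation]).  In particular K < 1 says that
    kappa < 0, so that II is Lorentzian.

    In dimension two the tension field of nu for a metric h is, up to the factor
    det h, the divergence of the cofactors of h applied to the gradient of nu,
    corrected by half the logarithmic derivative of det h ([tension_divergence]).
    For h = lam II these fields are multiples, by lam s, of
      E^0 = - B_1 - kappa A_1 x nu   and   E^1 = B_0 + kappa A_0 x nu
    ([cof_grad_dual]).  Up to multiples of nu, which the projection kills, the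
    divergence of E involves only the derivatives of kappa ([pdv_dual]).  The outcome
    is [tension_formula]:
      det h * tau = lam s / (2 kappa) * (kappa_0 P_1 - kappa_1 P_0),
    where P_l = B_l - kappa A_l x nu, and lam has dropped out of the vanishing of tau.

    If K is constant then so is kappa, and tau = 0 for every lam.  Conversely
    [P_0, P_1, nu] = kappa (1 + kappa) s = kappa K s, so tau = 0 forces K dK = 0.  The
    vectors P_l do become dependent where K = 0, so one cannot conclude dK = 0 at such
    a point directly; but K dK = 0 makes K^2 locally constant, continuity makes K
    locally constant, and M is connected.

    To use II itself as the Lorentzian metric, and to read K in an arbitrary chart,
    one needs that II transforms as a tensor ([second_form_transition]).  The calculus
    rests on two facts on functions of two variables: mixed derivatives commute
    ([pd_comm]), and a function without gradient is locally constant
    ([pd0_locally_constant]). *)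

(** * Smooth functions on open sets of the plane *)

Section Calculus.
Variable R : realType.
Notation plane := 'rV[R]_2.
Implicit Types (U : set plane) (f g : plane -> R) (k l : 'I_2) (x y : plane).

Lemma open_near U x (P : plane -> Prop) :
  open U -> U x -> (forall y, U y -> P y) -> \forall y \near x, P y.
Proof.
move=> oU Ux UP; apply: filterS UP _; exact: open_nbhs_nbhs.
Qed.

Lemma differentiable_near0 (V W : normedModType R) (f : V -> W) (x : V) :
  (\forall y \near x, f y = 0) -> differentiable f x.
Proof.
move=> f0; have fx0 : f x = 0 by exact: (nbhs_singleton f0).
have nf : \forall h \near (0 : V), f (h + x) = 0.
  by move: f0; rewrite (near_shift 0 x) subr0.
have o0 : f \o shift x =o_ (0 : V) (id : V -> V).
  apply/eqoP => e e0; near=> h.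
  have -> : (f \o shift x) h = 0 by rewrite /= /shift /=; near: h.
  by rewrite normr0 mulr_ge0 // ltW.
have z0 : cst (f x) + (\0 : {linear V -> W}) = 0 :> (V -> W).
  by apply/funext => y; rewrite !fctE fx0 /= addr0.
have E : f \o shift x = cst (f x) + (\0 : {linear V -> W}) +o_ 0 id.
  have -> : f \o shift x \- (cst (f x) + (\0 : {linear V -> W})) = f \o shift x.
    by apply/funext => y; rewrite z0 /= subr0.
  by rewrite z0 add0r.
have C : continuous (\0 : {linear V -> W}) by exact: cst_continuous.
apply/diff_locallyP; rewrite (diff_unique C E); split => //.
Unshelve. all: by end_near. Qed.

(** Two functions that agree near a point differ by one that vanishes near it. *)
Lemma near_eq_differentiable (V W : normedModType R) (f g : V -> W) (x : V) :
  (\forall y \near x, f y = g y) -> differentiable f x -> differentiable g x.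
Proof.
move=> fg df; have -> : g = f - (f - g).
  by apply/funext => y; rewrite !fctE opprB addrC subrK.
apply: differentiableB => //; apply: differentiable_near0.
by apply: filterS fg => y fgy; rewrite !fctE fgy subrr.
Qed.

Lemma eq_pd U k f g x : open U -> U x ->
  (forall y, U y -> f y = g y) -> pd k f x = pd k g x.
Proof.
by move=> oU Ux fg; apply: near_eq_derive; exact: open_near oU Ux fg.
Qed.

Lemma eq_Ck_on m U f g : open U -> (forall y, U y -> f y = g y) ->
  Ck_on m U f -> Ck_on m U g.
Proof.
elim: m f g => [|m IH] f g oU fg /=.
  move=> cf x Ux; have nfg := open_near oU Ux fg.
  rewrite /prop_for /continuous_at -(nbhs_singleton nfg).
  apply: cvg_trans (cf x Ux); apply: (@near_eq_cvg _ _ (nbhs x)).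
  exact: nfg.
move=> [df cf]; split=> [x Ux|k].
  apply: near_eq_differentiable (df x Ux); exact: open_near oU Ux fg.
apply: IH (cf k) => // y Uy; exact: eq_pd fg.
Qed.

Lemma Ck_onW m U f : Ck_on m.+1 U f -> Ck_on m U f.
Proof.
elim: m f => [|m IH] f [df cf].
  by move=> x Ux; apply: differentiable_continuous; exact: df.
by split=> // k; apply: IH; exact: cf.
Qed.

Lemma smooth_on_differentiable U f x : smooth_on U f -> U x -> differentiable f x.
Proof. by move=> sf; have [df _] := sf 1; exact: df. Qed.

Lemma smooth_on_derivable U f x v : smooth_on U f -> U x -> derivable f x v.
Proof. by move=> sf Ux; apply: diff_derivable; exact: smooth_on_differentiable sf Ux. Qed.

Lemma smooth_on_continuous U f x : smooth_on U f -> U x -> {for x, continuous f}.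
Proof. by move=> sf; exact: (sf 0). Qed.

Lemma smooth_on_pd U f k : smooth_on U f -> smooth_on U (pd k f).
Proof. by move=> sf m; have [_] := sf m.+1; exact. Qed.

Lemma eq_smooth_on U f g : open U -> (forall y, U y -> f y = g y) ->
  smooth_on U f -> smooth_on U g.
Proof. by move=> oU fg sf m; exact: eq_Ck_on (sf m). Qed.

Lemma Ck_on_cst m U (c : R) : Ck_on m U (fun=> c).
Proof.
elim: m c => [|m IH] c /=; first by move=> x _; exact: cst_continuous.
split=> [x _|k]; first exact: differentiable_cst.
have -> : pd k (fun=> c) = fun=> 0 :> R by apply/funext => x; exact: derive_cst.
exact: IH.
Qed.

Lemma smooth_on_cst U (c : R) : smooth_on U (fun=> c).
Proof. by move=> m; exact: Ck_on_cst. Qed.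

Lemma pdD k f g x : derivable f x (delta_mx 0 k) -> derivable g x (delta_mx 0 k) ->
  pd k (fun y => f y + g y) x = pd k f x + pd k g x.
Proof. by move=> df dg; rewrite /pd -deriveD. Qed.

Lemma pdN k f x : derivable f x (delta_mx 0 k) ->
  pd k (fun y => - f y) x = - pd k f x.
Proof. by move=> df; rewrite /pd -deriveN. Qed.

Lemma pdM k f g x : derivable f x (delta_mx 0 k) -> derivable g x (delta_mx 0 k) ->
  pd k (fun y => f y * g y) x = pd k f x * g x + f x * pd k g x.
Proof.
move=> df dg; rewrite /pd -[LHS]/('D_(delta_mx 0 k) (f * g) x) deriveM //=.
by rewrite addrC [g x *: _]mulrC.
Qed.

Lemma pdV k f x : derivable f x (delta_mx 0 k) -> f x != 0 ->
  pd k (fun y => (f y)^-1) x = - ((f x)^-1 * (f x)^-1 * pd k f x).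
Proof.
move=> df f0; rewrite /pd deriveV // -[_ *: _]/(_ * _) mulNr.
by rewrite -exprVn expr2.
Qed.

Lemma Ck_onD m U f g : open U ->
  Ck_on m U f -> Ck_on m U g -> Ck_on m U (fun y => f y + g y).
Proof.
move=> oU; elim: m f g => [|m IH] f g /=.
  by move=> cf cg x Ux; apply: continuousD; [exact: cf|exact: cg].
move=> [df cf] [dg cg]; split=> [x Ux|k].
  by apply: differentiableD; [exact: df|exact: dg].
apply: eq_Ck_on (IH _ _ (cf k) (cg k)) => // y Uy.
by rewrite pdD //; apply: diff_derivable; [exact: df|exact: dg].
Qed.

Lemma Ck_onN m U f : open U -> Ck_on m U f -> Ck_on m U (fun y => - f y).
Proof.
move=> oU; elim: m f => [|m IH] f /=.
  by move=> cf x Ux; apply: continuousN; exact: cf.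
move=> [df cf]; split=> [x Ux|k].
  by apply: differentiableN; exact: df.
apply: eq_Ck_on (IH _ (cf k)) => // y Uy.
by rewrite pdN //; apply: diff_derivable; exact: df.
Qed.

Lemma Ck_onM m U f g : open U ->
  Ck_on m U f -> Ck_on m U g -> Ck_on m U (fun y => f y * g y).
Proof.
move=> oU; elim: m f g => [|m IH] f g.
  by move=> cf cg x Ux; apply: continuousM; [exact: cf|exact: cg].
move=> cf1 cg1; have [df cf] := cf1; have [dg cg] := cg1.
split=> [x Ux|k].
  by apply: differentiableM; [exact: df|exact: dg].
have S := Ck_onD oU (IH _ _ (cf k) (Ck_onW cg1)) (IH _ _ (Ck_onW cf1) (cg k)).
apply: eq_Ck_on S => // y Uy.
by rewrite pdM //; apply: diff_derivable; [exact: df|exact: dg].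
Qed.

Lemma Ck_onV m U f : open U -> (forall y, U y -> f y != 0) ->
  Ck_on m U f -> Ck_on m U (fun y => (f y)^-1).
Proof.
move=> oU f0; elim: m => [|m IH].
  by move=> cf x Ux; apply: continuousV; [exact: f0|exact: cf].
move=> cf1; have [df cf] := cf1; have I := IH (Ck_onW cf1).
split=> [x Ux|k].
  by apply: differentiableV; [exact: df|exact: f0].
have S := Ck_onN oU (Ck_onM oU (Ck_onM oU I I) (cf k)).
apply: eq_Ck_on S => // y Uy.
by rewrite pdV ?f0 //; apply: diff_derivable; exact: df.
Qed.

Lemma smooth_onD U f g : open U -> smooth_on U f -> smooth_on U g ->
  smooth_on U (fun y => f y + g y).
Proof. by move=> oU sf sg m; exact: Ck_onD. Qed.

Lemma smooth_onN U f : open U -> smooth_on U f -> smooth_on U (fun y => - f y).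
Proof. by move=> oU sf m; exact: Ck_onN. Qed.

Lemma smooth_onB U f g : open U -> smooth_on U f -> smooth_on U g ->
  smooth_on U (fun y => f y - g y).
Proof. by move=> oU sf sg; apply: smooth_onD => //; exact: smooth_onN. Qed.

Lemma smooth_onM U f g : open U -> smooth_on U f -> smooth_on U g ->
  smooth_on U (fun y => f y * g y).
Proof. by move=> oU sf sg m; exact: Ck_onM. Qed.

Lemma smooth_onV U f : open U -> (forall y, U y -> f y != 0) ->
  smooth_on U f -> smooth_on U (fun y => (f y)^-1).
Proof. by move=> oU f0 sf m; exact: Ck_onV. Qed.

Lemma smooth_on_sum U n (F : 'I_n -> plane -> R) : open U ->
  (forall i, smooth_on U (F i)) -> smooth_on U (fun y => \sum_(i < n) F i y).
Proof.
move=> oU; elim: n F => [|n IH] F sF.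
  by apply: eq_smooth_on (smooth_on_cst U 0) => // y _; rewrite big_ord0.
apply: eq_smooth_on (smooth_onD oU (IH _ (fun i => sF (widen_ord (leqnSn n) i)))
  (sF ord_max)) => // y _.
by rewrite big_ord_recr.
Qed.

End Calculus.

(** * Mean values, mixed derivatives and locally constant functions *)

Section MeanValues.
Variable R : realType.
Notation plane := 'rV[R]_2.
Implicit Types (U : set plane) (f g : plane -> R) (k l : 'I_2) (x y v w : plane).

Lemma is_derive_line f x v (t : R) : derivable f (t *: v + x) v ->
  is_derive t 1 (fun s : R => f (s *: v + x)) ('D_v f (t *: v + x)).
Proof.
have E : (fun h : R => h^-1 *: (((fun s => f (s *: v + x)) \o shift t) (h *: 1)
    - f (t *: v + x))) =
  (fun h : R => h^-1 *: ((f \o shift (t *: v + x)) (h *: v) - f (t *: v + x))).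
  apply/funext => h; rewrite /= /shift /=.
  by rewrite -[h *: 1]/(h * 1) mulr1 scalerDl addrA.
move=> df; apply: DeriveDef; first by rewrite /derivable E.
by rewrite /derive E.
Qed.

Lemma line_continuous f x v (t : R) : derivable f (t *: v + x) v ->
  {for t, continuous (fun s : R => f (s *: v + x))}.
Proof.
move=> /is_derive_line [d _]; apply: differentiable_continuous.
exact/derivable1_diffP.
Qed.

Lemma MVT_line f x v (t : R) : 0 < t ->
  (forall s, 0 <= s <= t -> derivable f (s *: v + x) v) ->
  exists2 c, 0 < c < t & f (t *: v + x) - f x = 'D_v f (c *: v + x) * t.
Proof.
move=> t0 df.
have [||c c0t] := @MVT R (fun s : R => f (s *: v + x))
  (fun s => 'D_v f (s *: v + x)) 0 t t0.
- move=> s; rewrite in_itv /= => /andP[s0 st]; apply: is_derive_line.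
  by apply: df; rewrite !ltW.
- apply: continuous_in_subspaceT => s; rewrite inE /= in_itv /= => st.
  by apply: line_continuous; exact: df.
rewrite scale0r add0r subr0 => ->; exists c => //.
Qed.

Lemma norm_delta_mx k : `|delta_mx 0 k : plane| <= 1.
Proof.
rewrite /Num.Def.normr /= mx_normrE; apply: bigmax_le => // -[i j] _ /=.
by rewrite mxE; case: (_ && _); rewrite ?normr1 ?normr0.
Qed.

(** The mean value theorem in one variable and then in the other.  The second
    difference on the left is symmetric in [k] and [l], while the order of the
    derivatives on the right is not. *)
Lemma second_difference f k l x (t : R) : 0 < t ->
  (forall a b, 0 <= a <= t -> 0 <= b <= t ->
    differentiable f (b *: delta_mx 0 l + (a *: delta_mx 0 k + x)) /\
    differentiable (pd k f) (b *: delta_mx 0 l + (a *: delta_mx 0 k + x))) ->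
  exists a b, [/\ 0 < a < t, 0 < b < t &
    f (t *: delta_mx 0 k + (t *: delta_mx 0 l + x)) - f (t *: delta_mx 0 k + x)
    - f (t *: delta_mx 0 l + x) + f x =
    pd l (pd k f) (b *: delta_mx 0 l + (a *: delta_mx 0 k + x)) * t * t].
Proof.
move=> t0 df; set ek := delta_mx 0 k; set el := delta_mx 0 l.
have t0t : 0 <= t <= t by rewrite lexx ltW.
have t00 : (0 : R) <= 0 <= t by rewrite lexx ltW.
have d1 a : 0 <= a <= t -> derivable f (a *: ek + (t *: el + x)) ek.
  move=> a0; rewrite addrCA; apply: diff_derivable.
  by have [] := df _ _ a0 t0t.
have d2 a : 0 <= a <= t -> derivable f (a *: ek + x) ek.
  move=> a0; apply: diff_derivable.
  by have [] := df _ _ a0 t00; rewrite scale0r add0r.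
have [||a a0t] := @MVT R
  (fun s : R => f (s *: ek + (t *: el + x)) - f (s *: ek + x))
  (fun s => pd k f (s *: ek + (t *: el + x)) - pd k f (s *: ek + x)) 0 t t0.
- move=> s; rewrite in_itv /= => /andP[s0 st].
  have s0t : 0 <= s <= t by rewrite !ltW.
  by apply: is_deriveB; apply: is_derive_line; [exact: d1|exact: d2].
- apply: continuous_in_subspaceT => s; rewrite inE /= in_itv /= => st.
  by apply: continuousB; apply: line_continuous; [exact: d1|exact: d2].
move: a0t; rewrite in_itv /= => a0t; have [a0 at_] := andP a0t.
have a0t' : 0 <= a <= t by rewrite !ltW.
rewrite scale0r !add0r subr0 [a *: ek + (_ + _)]addrCA.
have [|b b0t ->] := @MVT_line (pd k f) (a *: ek + x) el t t0.
  by move=> s s0; apply: diff_derivable; have [] := df _ _ a0t' s0.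
move=> E; exists a, b; split => //; rewrite -E.
by ring.
Qed.

(** Both mixed derivatives approximate the same second difference: evaluate it by
    [second_difference] in the two orders and let the side of the square shrink. *)
Lemma pd_comm U f k l x : open U -> smooth_on U f -> U x ->
  pd k (pd l f) x = pd l (pd k f) x.
Proof.
move=> oU sf Ux; apply/eqP; rewrite -subr_eq0 -normr_le0.
apply/ler_addgt0Pr => e e0; rewrite add0r.
have c1 : {for x, continuous (pd k (pd l f))}.
  by apply: smooth_on_continuous Ux; do 2! apply: smooth_on_pd.
have c2 : {for x, continuous (pd l (pd k f))}.
  by apply: smooth_on_continuous Ux; do 2! apply: smooth_on_pd.
have e20 : 0 < e / 2 by rewrite divr_gt0.
have n1 : \forall y \near x, `|pd k (pd l f) x - pd k (pd l f) y| < e / 2.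
  by move/cvgrPdist_lt: c1; apply.
have n2 : \forall y \near x, `|pd l (pd k f) x - pd l (pd k f) y| < e / 2.
  by move/cvgrPdist_lt: c2; apply.
have nU : nbhs x U by exact: open_nbhs_nbhs.
have : \forall y \near x, [/\ U y, `|pd k (pd l f) x - pd k (pd l f) y| < e / 2
    & `|pd l (pd k f) x - pd l (pd k f) y| < e / 2].
  by apply: filterS3 nU n1 n2 => y.
move=> /nbhs_ballP[r /= r0 rP].
(* A third of the radius, so that the whole square lies in the ball. *)
pose t := r / 3.
have t0 : 0 < t by rewrite divr_gt0.
have B a b i j : 0 <= a <= t -> 0 <= b <= t ->
    ball x r (b *: delta_mx 0 j + (a *: delta_mx 0 i + x)).
  move=> /andP[a0 at_] /andP[b0 bt].
  rewrite -ball_normE /= addrA opprD addrCA subrr addr0 normrN.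
  apply: le_lt_trans (ler_normD _ _) _; rewrite !normrZ !ger0_norm //.
  have bq : b * `|delta_mx 0 j : plane| <= t.
    by rewrite (le_trans _ bt) // ler_piMr // norm_delta_mx.
  have ap : a * `|delta_mx 0 i : plane| <= t.
    by rewrite (le_trans _ at_) // ler_piMr // norm_delta_mx.
  apply: le_lt_trans (lerD bq ap) _.
  by rewrite -mulr2n -mulr_natr /t -mulrA gtr_pMr // ltr_pdivrMl // mulr1 ltr_nat.
have [|a [b [a0 b0 E1]]] := @second_difference f k l x t t0.
- move=> a b a0 b0; have [Uy _ _] := rP _ (B a b k l a0 b0).
  by split; apply: smooth_on_differentiable Uy => //; exact: smooth_on_pd.
have [|c [d [c0 d0 E2]]] := @second_difference f l k x t t0.
- move=> c d c0 d0; have [Uy _ _] := rP _ (B c d l k c0 d0).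
  by split; apply: smooth_on_differentiable Uy => //; exact: smooth_on_pd.
have W s : 0 < s < t -> 0 <= s <= t by move=> /andP[? ?]; rewrite !ltW.
have [_ _ P2] := rP _ (B a b k l (W _ a0) (W _ b0)).
have [_ P1 _] := rP _ (B c d l k (W _ c0) (W _ d0)).
move: E1 E2 P1 P2; rewrite [t *: delta_mx 0 l + (_ + _)]addrCA.
set p := pd l (pd k f) (_ + _); set q := pd k (pd l f) (_ + _).
move=> E1 E2 P1 P2.
have pq : p = q.
  have : p * t * t = q * t * t.
    apply: etrans (esym E1) (etrans _ E2).
    by congr (_ + _); exact: addrAC.
  by move=> /(mulIf (lt0r_neq0 t0)) /(mulIf (lt0r_neq0 t0)).
move: P1 P2; rewrite -pq; set u := pd k (pd l f) x; set w := pd l (pd k f) x.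
move=> P1 P2; have -> : u - w = (u - p) - (w - p) by rewrite opprB addrA subrK.
apply: le_trans (ler_normB _ _) (ltW _); rewrite [ltRHS]splitr.
exact: ltrD P1 P2.
Qed.

Lemma derive_pd f x v : differentiable f x ->
  'D_v f x = \sum_k v 0 k * pd k f x.
Proof.
move=> df; rewrite deriveE // {1}(row_sum_delta v) linear_sum.
by apply: eq_bigr => k _; rewrite linearZ /= /pd deriveE.
Qed.

(** The mean value theorem along the segments of a ball, which is convex. *)
Lemma pd0_locally_constant U f x : open U -> smooth_on U f -> U x ->
  (forall k y, U y -> pd k f y = 0) -> \forall y \near x, f y = f x.
Proof.
move=> oU sf Ux pd0.
have : nbhs x U by exact: open_nbhs_nbhs.
move=> /nbhs_ballP[r /= r0 rP].
apply/nbhs_ballP; exists r => //= y; rewrite -ball_normE /= => yr.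
have B s : 0 <= s <= 1 -> U (s *: (y - x) + x).
  move=> /andP[s0 s1]; apply: rP; rewrite -ball_normE /=.
  rewrite opprD addrCA subrr addr0 normrN normrZ ger0_norm //.
  by rewrite distrC in yr; apply: le_lt_trans yr; rewrite ler_piMl.
have [|c /andP[c0 c1]] := @MVT_line f x (y - x) 1 ltr01.
  by move=> s s01; apply: smooth_on_derivable sf _; exact: B.
have Uc : U (c *: (y - x) + x) by apply: B; rewrite !ltW.
rewrite scale1r subrK derive_pd; last exact: smooth_on_differentiable sf Uc.
rewrite big1 ?mul0r; last by move=> k _; rewrite pd0 ?mulr0.
by move/eqP; rewrite subr_eq0 => /eqP.
Qed.

Lemma pd_comp (phi : plane -> plane) f k x :
  differentiable phi x -> differentiable f (phi x) ->
  pd k (f \o phi) x = \sum_a (jacobian phi x) k a * pd a f (phi x).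
Proof.
move=> dphi df; have dc := differentiable_comp dphi df.
rewrite /pd deriveE // diff_comp //= -deriveE // derive_pd //.
by apply: eq_bigr => a _; rewrite /jacobian /lin1_mx mxE.
Qed.

End MeanValues.

(** * Vector algebra in three dimensions *)

Section Vectors.
Variable R : realType.
Notation vec := 'rV[R]_3.
Implicit Types (u v w : vec) (a b c : R).

Definition vec3 a b c : vec := \row_j [:: a; b; c]`_j.

Definition dot u v : R := \sum_j u 0 j * v 0 j.

Definition cross u v : vec :=
  let x (w : vec) i := w 0 (inord i) in
  vec3 (x u 1 * x v 2 - x u 2 * x v 1) (x u 2 * x v 0 - x u 0 * x v 2)
       (x u 0 * x v 1 - x u 1 * x v 0).

Definition det3 u v w : R := dot (cross u v) w.

Lemma vec3_0 a b c : vec3 a b c 0 (inord 0) = a.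
Proof. by rewrite mxE inordK. Qed.
Lemma vec3_1 a b c : vec3 a b c 0 (inord 1) = b.
Proof. by rewrite mxE inordK. Qed.
Lemma vec3_2 a b c : vec3 a b c 0 (inord 2) = c.
Proof. by rewrite mxE inordK. Qed.

Lemma ord3P (P : 'I_3 -> Prop) :
  P (inord 0) -> P (inord 1) -> P (inord 2) -> forall j, P j.
Proof.
by move=> P0 P1 P2 j; rewrite -(inord_val j); case: j => [[|[|[|//]]] ?] /=.
Qed.

Lemma vecP u v : u 0 (inord 0) = v 0 (inord 0) -> u 0 (inord 1) = v 0 (inord 1) ->
  u 0 (inord 2) = v 0 (inord 2) -> u = v.
Proof. by move=> *; apply/rowP; apply: ord3P. Qed.

Lemma vec3E u : u = vec3 (u 0 (inord 0)) (u 0 (inord 1)) (u 0 (inord 2)).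
Proof. by apply: vecP; rewrite ?vec3_0 ?vec3_1 ?vec3_2. Qed.

Lemma dotE u v : dot u v = u 0 (inord 0) * v 0 (inord 0)
  + u 0 (inord 1) * v 0 (inord 1) + u 0 (inord 2) * v 0 (inord 2).
Proof.
rewrite /dot !big_ord_recl big_ord0 addr0 addrA.
by do ![congr (_ + _)]; congr (_ * _); congr (fun_of_matrix _ _ _);
  apply: val_inj; rewrite /= inordK.
Qed.

Lemma crossE u v : cross u v =
  vec3 (u 0 (inord 1) * v 0 (inord 2) - u 0 (inord 2) * v 0 (inord 1))
       (u 0 (inord 2) * v 0 (inord 0) - u 0 (inord 0) * v 0 (inord 2))
       (u 0 (inord 0) * v 0 (inord 1) - u 0 (inord 1) * v 0 (inord 0)).
Proof. by []. Qed.

Definition coordE := (vec3_0, vec3_1, vec3_2, mxE).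

Lemma dotC u v : dot u v = dot v u.
Proof. by apply: eq_bigr => j _; rewrite mulrC. Qed.

Lemma dotDl u v w : dot (u + v) w = dot u w + dot v w.
Proof. by rewrite !dotE !mxE; ring. Qed.

Lemma dotZl a u v : dot (a *: u) v = a * dot u v.
Proof. by rewrite !dotE !mxE; ring. Qed.

Lemma dotNl u v : dot (- u) v = - dot u v.
Proof. by rewrite -scaleN1r dotZl mulN1r. Qed.

Lemma dotBl u v w : dot (u - v) w = dot u w - dot v w.
Proof. by rewrite dotDl dotNl. Qed.

Lemma dotDr u v w : dot w (u + v) = dot w u + dot w v.
Proof. by rewrite dotC dotDl !(dotC w). Qed.

Lemma dotZr a u v : dot u (a *: v) = a * dot u v.
Proof. by rewrite dotC dotZl dotC. Qed.

Lemma dotNr u v : dot u (- v) = - dot u v.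
Proof. by rewrite dotC dotNl dotC. Qed.

Lemma dot0l u : dot 0 u = 0.
Proof. by rewrite -(scale0r 0) dotZl mul0r. Qed.

Lemma crossDl u v w : cross (u + v) w = cross u w + cross v w.
Proof. by rewrite !crossE; apply: vecP; rewrite !coordE; ring. Qed.

Lemma crossZl a u v : cross (a *: u) v = a *: cross u v.
Proof. by rewrite !crossE; apply: vecP; rewrite !coordE; ring. Qed.

Lemma crossC u v : cross u v = - cross v u.
Proof. by rewrite !crossE; apply: vecP; rewrite !coordE; ring. Qed.

Lemma crossNl u v : cross (- u) v = - cross u v.
Proof. by rewrite -scaleN1r crossZl scaleN1r. Qed.

Lemma crossDr u v w : cross w (u + v) = cross w u + cross w v.
Proof. by rewrite crossC crossDl opprD -!crossC. Qed.

Lemma crossZr a u v : cross u (a *: v) = a *: cross u v.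
Proof. by rewrite crossC crossZl -scalerN -crossC. Qed.

Lemma crossNr u v : cross u (- v) = - cross u v.
Proof. by rewrite -scaleN1r crossZr scaleN1r. Qed.

Lemma cross0r u : cross u 0 = 0.
Proof. by rewrite -[in LHS](scale0r 0) crossZr scale0r. Qed.

Lemma crossvv u : cross u u = 0.
Proof. by rewrite crossE; apply: vecP; rewrite !coordE; ring. Qed.

Lemma cross_cross u v w : cross u (cross v w) = dot u w *: v - dot u v *: w.
Proof. by rewrite !crossE !dotE; apply: vecP; rewrite !coordE; ring. Qed.

Lemma dot_cross_cycle u v w : dot (cross u v) w = dot (cross v w) u.
Proof. by rewrite !crossE !dotE !coordE; ring. Qed.

Lemma dot_crossl u v : dot (cross u v) u = 0.
Proof. by rewrite !crossE !dotE !coordE; ring. Qed.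

Lemma dot_crossr u v : dot (cross u v) v = 0.
Proof. by rewrite !crossE !dotE !coordE; ring. Qed.

Lemma dot_cross_cross u v w z :
  dot (cross u v) (cross w z) = dot u w * dot v z - dot u z * dot v w.
Proof. by rewrite !crossE !dotE !coordE; ring. Qed.

(** [nu x (u x v)] vanishes when [u] and [v] are orthogonal to [nu], so that [u x v]
    is its own component along [nu]. *)
Lemma cross_tangent nu u v : dot nu nu = 1 -> dot u nu = 0 -> dot v nu = 0 ->
  cross u v = det3 u v nu *: nu.
Proof.
move=> n1 un vn; have := cross_cross nu nu (cross u v).
rewrite n1 scale1r (cross_cross nu u v) ![dot nu _]dotC un vn !scale0r subr0.
by rewrite cross0r => /esym/eqP; rewrite subr_eq0 => /eqP.
Qed.

End Vectors.

(** * Frames of a plane orthogonal to a unit vector; vector fields *)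

(** Below, the vectors [A0], [A1] stand for the translated tangent frame and [B0], [B1]
    for the translated derivatives of the normal; [AB_sym] is the symmetry of the
    second fundamental form. *)
Section PlanarFrames.
Variable R : realType.
Notation vec := 'rV[R]_3.
Variable nu : vec.
Hypothesis nu1 : dot nu nu = 1.
Implicit Types (X Y Z : vec) (c : R).

Lemma planar_cross X Y Z : dot X nu = 0 -> dot Y nu = 0 ->
  dot Z Y *: X - dot Z X *: Y = det3 X Y nu *: cross Z nu.
Proof. by move=> tX tY; rewrite -cross_cross (cross_tangent nu1 tX tY) crossZr. Qed.

Lemma cross_nuK X : dot X nu = 0 -> cross (cross X nu) nu = - X.
Proof.
by move=> tX; rewrite crossC cross_cross nu1 dotC tX scale0r subr0 scale1r.
Qed.

Lemma det3_cross_nu X Y : dot X nu = 0 -> det3 X (cross Y nu) nu = - dot X Y.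
Proof.
by move=> tX; rewrite /det3 cross_cross tX scale0r sub0r dotNl dotZl nu1 mulr1.
Qed.

Lemma det3C X Y Z : det3 X Y Z = - det3 Y X Z.
Proof. by rewrite /det3 crossC dotNl. Qed.

Lemma det3BZ X Y X' Y' c Z : det3 (X - c *: X') (Y - c *: Y') Z =
  det3 X Y Z - c * (det3 X Y' Z + det3 X' Y Z) + c * c * det3 X' Y' Z.
Proof. by rewrite /det3 !crossE !dotE !coordE; ring. Qed.

Variables A0 A1 B0 B1 : vec.
Hypotheses (tA0 : dot A0 nu = 0) (tA1 : dot A1 nu = 0).
Hypotheses (tB0 : dot B0 nu = 0) (tB1 : dot B1 nu = 0).
Hypothesis AB_sym : dot A0 B1 = dot A1 B0.

(** The terms linear in [c] are entries of the second fundamental form and cancel by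
    its symmetry.  The value [c = 1] gives the area spanned by the derivatives of the
    Gauss map, the value [c = kappa] the independence of the two vectors in the
    tension formula. *)
Lemma det3_pencil c :
  det3 (B0 - c *: cross A0 nu) (B1 - c *: cross A1 nu) nu
  = det3 B0 B1 nu + c * c * det3 A0 A1 nu.
Proof.
rewrite det3BZ det3_cross_nu // (det3C (cross A0 nu)) det3_cross_nu //.
rewrite det3_cross_nu; last by rewrite dot_crossr.
rewrite opprK (dotC B0) -AB_sym (dotC B1) addNr mulr0 subr0.
congr (_ + _ * _).
by rewrite dot_cross_cycle dot_cross_cycle -/(det3 A1 A0 nu) -det3C.
Qed.

(** The left-hand sides are the cofactors of the second fundamental form applied to
    the derivatives [B_k - A_k x nu] of the Gauss map.  Cofactors turn the pairing with
    the frame into a quarter turn: [planar_cross] applied with the pair [B0], [B1]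
    gives the part containing the [B_k], and with the pair [A0], [A1] the rest. *)
Lemma cross_sym_form c : c * det3 A0 A1 nu = det3 B0 B1 nu ->
  - dot A1 B1 *: (B0 - cross A0 nu) + dot A0 B1 *: (B1 - cross A1 nu)
    = det3 A0 A1 nu *: (- B1 - c *: cross A1 nu) /\
  - dot A0 B0 *: (B1 - cross A1 nu) + dot A0 B1 *: (B0 - cross A0 nu)
    = det3 A0 A1 nu *: (B0 + c *: cross A0 nu).
Proof.
move=> cs.
have eA1 := planar_cross A1 tB0 tB1.
have eA0 := planar_cross A0 tB0 tB1.
have eB0 : dot B0 A1 *: cross A0 nu - dot B0 A0 *: cross A1 nu
    = - (det3 A0 A1 nu *: B0).
  have := congr1 (fun v => cross v nu) (planar_cross B0 tA0 tA1).
  by rewrite /= crossDl crossNl !crossZl cross_nuK // scalerN.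
have eB1 : dot B1 A1 *: cross A0 nu - dot B1 A0 *: cross A1 nu
    = - (det3 A0 A1 nu *: B1).
  have := congr1 (fun v => cross v nu) (planar_cross B1 tA0 tA1).
  by rewrite /= crossDl crossNl !crossZl cross_nuK // scalerN.
rewrite -cs -!scalerA -?AB_sym in eA0 eA1.
rewrite !(dotC B0) !(dotC B1) -?AB_sym in eB0 eB1.
split.
- transitivity (- (dot A1 B1 *: B0 - dot A0 B1 *: B1)
      + (dot A1 B1 *: cross A0 nu - dot A0 B1 *: cross A1 nu)).
    by apply: vecP; rewrite !mxE; ring.
  by rewrite eA1 eB1; apply: vecP; rewrite !mxE; ring.
- transitivity ((dot A0 B1 *: B0 - dot A0 B0 *: B1)
      - (dot A0 B1 *: cross A0 nu - dot A0 B0 *: cross A1 nu)).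
    by apply: vecP; rewrite !mxE; ring.
  by rewrite eA0 eB0; apply: vecP; rewrite !mxE; ring.
Qed.

Lemma det_sym_form :
  dot A0 B0 * dot A1 B1 - dot A0 B1 * dot A0 B1 = det3 A0 A1 nu * det3 B0 B1 nu.
Proof.
have := dot_cross_cross A0 A1 B0 B1; rewrite -AB_sym => <-.
by rewrite (cross_tangent nu1 tA0 tA1) (cross_tangent nu1 tB0 tB1)
  dotZl dotZr nu1 mulr1.
Qed.

Lemma det_gram : dot A0 A0 * dot A1 A1 - dot A0 A1 * dot A0 A1
  = det3 A0 A1 nu * det3 A0 A1 nu.
Proof.
have := dot_cross_cross A0 A1 A0 A1; rewrite (dotC A1 A0) => <-.
by rewrite (cross_tangent nu1 tA0 tA1) dotZl dotZr nu1 mulr1.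
Qed.

End PlanarFrames.

Section VectorCalculus.
Variable R : realType.
Notation vec := 'rV[R]_3.
Notation plane := 'rV[R]_2.
Implicit Types (X Y : plane -> vec) (f : plane -> R) (k l : 'I_2) (x y : plane).

(** Componentwise, so that the derivative of a vector field needs no hypothesis to be
    expressed by partial derivatives of real functions. *)
Definition pdv k X x : vec := \row_j pd k (fun y => X y 0 j : R) x.

Lemma pdvE k X x j : pdv k X x 0 j = pd k (fun y => X y 0 j : R) x.
Proof. by rewrite mxE. Qed.

Variable U : set plane.
Hypothesis oU : open U.

Definition vsmooth X := forall j, smooth_on U (fun y => X y 0 j : R).

Lemma eq_pdv k X Y x : U x -> (forall y, U y -> X y = Y y) -> pdv k X x = pdv k Y x.
Proof.
move=> Ux XY; apply/rowP => j; rewrite !mxE.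
by apply: (eq_pd _ oU Ux) => y Uy; rewrite XY.
Qed.

Lemma eq_vsmooth X Y : (forall y, U y -> X y = Y y) -> vsmooth X -> vsmooth Y.
Proof.
by move=> XY sX j; apply: eq_smooth_on (sX j) => // y Uy; rewrite XY.
Qed.

Lemma vsmooth_pdv k X : vsmooth X -> vsmooth (pdv k X).
Proof.
move=> sX j; have -> : (fun y => pdv k X y 0 j) = pd k (fun y => X y 0 j).
  by apply/funext => y; rewrite mxE.
exact: smooth_on_pd.
Qed.

Lemma smooth_dot X Y : vsmooth X -> vsmooth Y -> smooth_on U (fun y => dot (X y) (Y y)).
Proof.
by move=> sX sY; apply: smooth_on_sum => // j; apply: smooth_onM.
Qed.

Lemma vsmooth_cross X Y : vsmooth X -> vsmooth Y -> vsmooth (fun y => cross (X y) (Y y)).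
Proof.
move=> sX sY.
have S a b : smooth_on U (fun y => X y 0 (inord a) * Y y 0 (inord b)
    - X y 0 (inord b) * Y y 0 (inord a)).
  by apply: smooth_onB => //; apply: smooth_onM.
apply: ord3P; [apply: eq_smooth_on (S 1 2) | apply: eq_smooth_on (S 2 0)
  | apply: eq_smooth_on (S 0 1)] => // y _; by rewrite crossE !coordE.
Qed.

Lemma vsmoothD X Y : vsmooth X -> vsmooth Y -> vsmooth (fun y => X y + Y y).
Proof.
move=> sX sY j; apply: eq_smooth_on (smooth_onD oU (sX j) (sY j)) => // y _.
by rewrite mxE.
Qed.

Lemma vsmoothZ f X : smooth_on U f -> vsmooth X -> vsmooth (fun y => f y *: X y).
Proof.
move=> sf sX j; apply: eq_smooth_on (smooth_onM oU sf (sX j)) => // y _.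
by rewrite mxE.
Qed.

Lemma vsmoothN X : vsmooth X -> vsmooth (fun y => - X y).
Proof.
move=> sX j; apply: eq_smooth_on (smooth_onN oU (sX j)) => // y _.
by rewrite mxE.
Qed.

Lemma pdvD k X Y x : U x -> vsmooth X -> vsmooth Y ->
  pdv k (fun y => X y + Y y) x = pdv k X x + pdv k Y x.
Proof.
move=> Ux sX sY; apply/rowP => j; rewrite !mxE.
under [X in pd k X]funext do rewrite mxE.
by rewrite pdD //; apply: smooth_on_derivable Ux.
Qed.

Lemma pdvN k X x : U x -> vsmooth X -> pdv k (fun y => - X y) x = - pdv k X x.
Proof.
move=> Ux sX; apply/rowP => j; rewrite !mxE.
under [X in pd k X]funext do rewrite mxE.
by rewrite pdN //; apply: smooth_on_derivable Ux.
Qed.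

Lemma pdvZ k f X x : U x -> smooth_on U f -> vsmooth X ->
  pdv k (fun y => f y *: X y) x = pd k f x *: X x + f x *: pdv k X x.
Proof.
move=> Ux sf sX; apply/rowP => j; rewrite !mxE.
under [X in pd k X]funext do rewrite mxE.
by rewrite pdM //; apply: smooth_on_derivable Ux.
Qed.

Lemma pd_dot k X Y x : U x -> vsmooth X -> vsmooth Y ->
  pd k (fun y => dot (X y) (Y y)) x = dot (pdv k X x) (Y x) + dot (X x) (pdv k Y x).
Proof.
move=> Ux sX sY.
under [X in pd k X]funext do rewrite dotE.
have S a : smooth_on U (fun y => X y 0 (inord a) * Y y 0 (inord a)).
  exact: smooth_onM.
have D a : derivable (fun y => X y 0 (inord a) * Y y 0 (inord a)) x (delta_mx 0 k).
  exact: smooth_on_derivable (S a) Ux.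
have dX j : derivable (fun y => X y 0 j) x (delta_mx 0 k).
  exact: smooth_on_derivable (sX j) Ux.
have dY j : derivable (fun y => Y y 0 j) x (delta_mx 0 k).
  exact: smooth_on_derivable (sY j) Ux.
rewrite pdD //; last exact: smooth_on_derivable (smooth_onD oU (S _) (S _)) Ux.
by rewrite pdD // !pdM // !dotE !mxE; ring.
Qed.

Lemma pdv_cross k X Y x : U x -> vsmooth X -> vsmooth Y ->
  pdv k (fun y => cross (X y) (Y y)) x
  = cross (pdv k X x) (Y x) + cross (X x) (pdv k Y x).
Proof.
move=> Ux sX sY.
have dX j : derivable (fun y => X y 0 j) x (delta_mx 0 k).
  exact: smooth_on_derivable (sX j) Ux.
have dY j : derivable (fun y => Y y 0 j) x (delta_mx 0 k).
  exact: smooth_on_derivable (sY j) Ux.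
have D a b : derivable (fun y => X y 0 (inord a) * Y y 0 (inord b)) x (delta_mx 0 k).
  exact: smooth_on_derivable (smooth_onM oU (sX _) (sY _)) Ux.
have DN a b : derivable (fun y => - (X y 0 (inord a) * Y y 0 (inord b))) x
    (delta_mx 0 k).
  exact: smooth_on_derivable (smooth_onN oU (smooth_onM oU (sX _) (sY _))) Ux.
apply: vecP; rewrite !crossE mxE; under [X in pd k X]funext do rewrite crossE !coordE;
  by rewrite pdD // pdN // !pdM // !coordE; ring.
Qed.

Lemma pdv_comm k l X x : U x -> vsmooth X ->
  pdv k (pdv l X) x = pdv l (pdv k X) x.
Proof.
move=> Ux sX; apply/rowP => j.
have E m n : pdv m (pdv n X) x 0 j = pd m (pd n (fun y => X y 0 j)) x.
  by rewrite mxE; congr (pd m _ x); apply/funext => y; rewrite mxE.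
apply: etrans (E k l) (etrans _ (esym (E l k))).
exact: (pd_comm k l oU (sX j) Ux).
Qed.

End VectorCalculus.

(** * Two-by-two matrices and Christoffel symbols *)

Section PlaneMatrices.
Variable R : realType.
Implicit Types (H : 'M[R]_2).

Lemma ord2P (P : 'I_2 -> Prop) : P 0 -> P 1 -> forall k, P k.
Proof.
move=> P0 P1 [[|[|//]] lt_k].
  by have -> : Ordinal lt_k = 0 by apply: val_inj.
by have -> : Ordinal lt_k = 1 by apply: val_inj.
Qed.

Lemma sum2 (V : nmodType) (F : 'I_2 -> V) : \sum_(k < 2) F k = F 0 + F 1.
Proof.
rewrite !big_ord_recl big_ord0 addr0; congr (_ + F _); exact: val_inj.
Qed.

Lemma det22 H : \det H = H 0 0 * H 1 1 - H 0 1 * H 1 0.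
Proof.
have l01 : lift 0 0 = 1 :> 'I_2 by apply: val_inj.
have l10 : lift 1 0 = 0 :> 'I_2 by apply: val_inj.
rewrite (expand_det_row H 0) sum2 /cofactor !det_mx11 !mxE.
rewrite ?l01 ?l10 expr0 mul1r expr1 mulN1r mulrN; by [].
Qed.

Lemma invmx22 H : \det H != 0 ->
  [/\ invmx H 0 0 = H 1 1 / \det H, invmx H 0 1 = - H 0 1 / \det H,
      invmx H 1 0 = - H 1 0 / \det H & invmx H 1 1 = H 0 0 / \det H].
Proof.
move=> d0; pose C : 'M[R]_2 := \matrix_(i, j)
  ((if i == j then H (1 - i) (1 - i) else - H i j) / \det H).
have n01 : (0 == 1 :> 'I_2) = false by [].
have n10 : (1 == 0 :> 'I_2) = false by [].
have o11 : 1 - 1 = 0 :> 'I_2 by apply: val_inj.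
have o10 : 1 - 0 = 1 :> 'I_2 by apply: val_inj.
have E : H *m C = 1%:M.
  apply/matrixP; apply: ord2P; apply: ord2P;
    rewrite !mxE sum2 !mxE !eqxx ?n01 ?n10 ?o11 ?o10;
    rewrite ?mulr1n ?mulr0n det22; field; by rewrite -det22.
have uH : H \in unitmx by rewrite unitmxE unitfE.
have -> : invmx H = C by rewrite -[RHS](mulKmx uH) E mulmx1.
by split; rewrite mxE ?eqxx ?n01 ?n10 ?o11 ?o10.
Qed.

End PlaneMatrices.

Section Christoffel.
Variable R : realType.
Notation plane := 'rV[R]_2.
Variables (U : set plane) (H : plane -> 'M[R]_2).
Hypothesis oU : open U.
Hypothesis sH : forall k l, smooth_on U (fun y => H y k l : R).
Hypothesis symH : forall y, U y -> H y 1 0 = H y 0 1.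
Hypothesis detH : forall y, U y -> \det (H y) != 0.
Implicit Types (k l m s : 'I_2) (x y : plane).

(** The same formula as for the symbols of a metric on a surface, so that the two are
    convertible once [H] is the metric read in a chart. *)
Definition christ k l m x : R :=
  2^-1 * \sum_(s < 2) (invmx (H x)) m s *
    (pd k (fun y => H y l s : R) x + pd l (fun y => H y k s : R) x
     - pd s (fun y => H y k l : R) x).

Lemma smooth_det : smooth_on U (fun y => \det (H y)).
Proof.
apply: eq_smooth_on (smooth_onB oU (smooth_onM oU (sH 0 0) (sH 1 1))
  (smooth_onM oU (sH 0 1) (sH 1 0))) => // y _.
by rewrite det22.
Qed.

Lemma smooth_inv i j : smooth_on U (fun y => invmx (H y) i j).
Proof.
have S (f : plane -> R) : smooth_on U f -> smooth_on U (fun y => f y / \det (H y)).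
  by move=> sf; apply: smooth_onM => //; exact: smooth_onV smooth_det.
move: i j; apply: ord2P; apply: ord2P.
- apply: eq_smooth_on (S _ (sH 1 1)) => // y Uy.
  by have [-> _ _ _] := invmx22 (detH Uy).
- apply: eq_smooth_on (S _ (smooth_onN oU (sH 0 1))) => // y Uy.
  by have [_ -> _ _] := invmx22 (detH Uy).
- apply: eq_smooth_on (S _ (smooth_onN oU (sH 1 0))) => // y Uy.
  by have [_ _ -> _] := invmx22 (detH Uy).
- apply: eq_smooth_on (S _ (sH 0 0)) => // y Uy.
  by have [_ _ _ ->] := invmx22 (detH Uy).
Qed.

Lemma smooth_christ k l m : smooth_on U (christ k l m).
Proof.
apply: smooth_onM => //; first exact: smooth_on_cst.
apply: smooth_on_sum => // s; apply: smooth_onM => //; first exact: smooth_inv.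
by apply: smooth_onB => //; [apply: smooth_onD => //|];
  apply: smooth_on_pd; exact: sH.
Qed.

(** The inverse matrix cancels: these are the symbols of the first kind. *)
Lemma christ_lower k l s x : U x ->
  \sum_m christ k l m x * H x m s = 2^-1 *
   (pd k (fun y => H y l s : R) x + pd l (fun y => H y k s : R) x
     - pd s (fun y => H y k l : R) x).
Proof.
move=> Ux; have [i00 i01 i10 i11] := invmx22 (detH Ux).
rewrite /christ; set c := fun s => pd k (fun y => H y l s : R) x
  + pd l (fun y => H y k s : R) x - pd s (fun y => H y k l : R) x.
rewrite -/(c s) !sum2 -!/(c _); move: (c) => {}c.
rewrite i00 i01 i10 i11 (symH Ux); have := detH Ux.
rewrite det22 (symH Ux) => d0.
by move: s; apply: ord2P; rewrite ?(symH Ux); field.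
Qed.

End Christoffel.

(** * The tension field as a weighted divergence *)

#[local] Opaque dot cross pdv pd.

Section Projection.
Variable R : realType.
Notation vec := 'rV[R]_3.
Implicit Types (n v w : vec).

Definition proj n w : vec := w - dot w n *: n.

Lemma projD n v w : proj n (v + w) = proj n v + proj n w.
Proof. by rewrite /proj dotDl scalerDl opprD addrACA. Qed.

Lemma projZ n (a : R) w : proj n (a *: w) = a *: proj n w.
Proof. by rewrite /proj dotZl -scalerA scalerBr. Qed.

Lemma proj_normal n (a : R) : dot n n = 1 -> proj n (a *: n) = 0.
Proof. by move=> n1; rewrite projZ /proj n1 scale1r subrr scaler0. Qed.

Lemma proj_tangent n w : dot w n = 0 -> proj n w = w.
Proof. by move=> wn; rewrite /proj wn scale0r subr0. Qed.

(** Collects the second derivatives [w k l] and the traces of the coefficients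
    [c k l m] under a single projection. *)
Lemma proj_comb n (a : 'I_2 -> 'I_2 -> R) (w : 'I_2 -> 'I_2 -> vec)
    (c : 'I_2 -> 'I_2 -> 'I_2 -> R) (v : 'I_2 -> vec) :
  \sum_(k < 2) \sum_(l < 2) a k l *: proj n (w k l - \sum_(m < 2) c k l m *: v m)
  = proj n (a 0 0 *: w 0 0 + a 0 1 *: w 0 1 + a 1 0 *: w 1 0 + a 1 1 *: w 1 1
    - (a 0 0 * c 0 0 0 + a 0 1 * c 0 1 0 + a 1 0 * c 1 0 0 + a 1 1 * c 1 1 0) *: v 0
    - (a 0 0 * c 0 0 1 + a 0 1 * c 0 1 1 + a 1 0 * c 1 0 1 + a 1 1 * c 1 1 1) *: v 1).
Proof.
rewrite !sum2 -!projZ -!projD; congr (proj n _).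
by apply: vecP; rewrite !mxE; ring.
Qed.

End Projection.

Section TensionDivergence.
Variable R : realType.
Notation vec := 'rV[R]_3.
Notation plane := 'rV[R]_2.
Variables (U : set plane) (H : plane -> 'M[R]_2) (nu : plane -> vec).
Hypothesis oU : open U.
Hypothesis sH : forall k l, smooth_on U (fun y => H y k l : R).
Hypothesis symH : forall y, U y -> H y 1 0 = H y 0 1.
Hypothesis detH : forall y, U y -> \det (H y) != 0.
Hypothesis snu : vsmooth U nu.

(** The tension field of a map [nu] into the unit sphere of R^3 for the metric [H]. *)
Definition vtension x : vec :=
  \sum_(k < 2) \sum_(l < 2) (invmx (H x)) k l *:
    proj (nu x) (pdv k (pdv l nu) x - \sum_(m < 2) christ H k l m x *: pdv m nu x).

(** The two components of the matrix of cofactors of [H] applied to the gradient of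
    [nu]. *)
Definition cof_grad0 y : vec := H y 1 1 *: pdv 0 nu y - H y 0 1 *: pdv 1 nu y.
Definition cof_grad1 y : vec := H y 0 0 *: pdv 1 nu y - H y 0 1 *: pdv 0 nu y.

Lemma pd_det k x : U x -> pd k (fun y => \det (H y)) x =
  pd k (fun y => H y 0 0 : R) x * H x 1 1 + H x 0 0 * pd k (fun y => H y 1 1 : R) x
  - 2 * H x 0 1 * pd k (fun y => H y 0 1 : R) x.
Proof.
move=> Ux.
have D i j : derivable (fun y => H y i j : R) x (delta_mx 0 k).
  exact: smooth_on_derivable (sH i j) Ux.
have DM i j i' j' : derivable (fun y => H y i j * H y i' j' : R) x (delta_mx 0 k).
  exact: smooth_on_derivable (smooth_onM oU (sH i j) (sH i' j')) Ux.
have DN i j i' j' : derivable (fun y => - (H y i j * H y i' j') : R) x (delta_mx 0 k).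
  exact: smooth_on_derivable (smooth_onN oU (smooth_onM oU (sH i j) (sH i' j'))) Ux.
rewrite (@eq_pd _ U k _ (fun y => H y 0 0 * H y 1 1 + - (H y 0 1 * H y 0 1)) x oU Ux).
  rewrite (pdD (DM _ _ _ _) (DN _ _ _ _)) (pdN (DM _ _ _ _)).
  by rewrite (pdM (D 0 0) (D 1 1)) (pdM (D 0 1) (D 0 1)); ring.
by move=> y Uy; rewrite det22 symH.
Qed.

Lemma christE k l m x : christ H k l m x = 2^-1 *
  (invmx (H x) m 0 * (pd k (fun y => H y l 0 : R) x + pd l (fun y => H y k 0 : R) x
     - pd 0 (fun y => H y k l : R) x)
  + invmx (H x) m 1 * (pd k (fun y => H y l 1 : R) x + pd l (fun y => H y k 1 : R) x
     - pd 1 (fun y => H y k l : R) x)).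
Proof. by rewrite /christ sum2. Qed.

Definition christ_trace m x : R :=
  invmx (H x) 0 0 * christ H 0 0 m x + invmx (H x) 0 1 * christ H 0 1 m x
  + invmx (H x) 1 0 * christ H 1 0 m x + invmx (H x) 1 1 * christ H 1 1 m x.

(** This is the classical formula for the trace of the Christoffel symbols as minus
    |det H|^(-1/2) times the divergence of |det H|^(1/2) H^-1.  In dimension two,
    writing H^-1 with cofactors removes the square roots and the sign of det H. *)
Lemma christ_traceE x : U x ->
  \det (H x) * christ_trace 0 x =
    pd 1 (fun y => H y 0 1 : R) x - pd 0 (fun y => H y 1 1 : R) x
    + (H x 1 1 * pd 0 (fun y => \det (H y)) x - H x 0 1 * pd 1 (fun y => \det (H y)) x)
      / (2 * \det (H x)) /\
  \det (H x) * christ_trace 1 x =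
    pd 0 (fun y => H y 0 1 : R) x - pd 1 (fun y => H y 0 0 : R) x
    + (H x 0 0 * pd 1 (fun y => \det (H y)) x - H x 0 1 * pd 0 (fun y => \det (H y)) x)
      / (2 * \det (H x)).
Proof.
move=> Ux; have S k : pd k (fun y => H y 1 0 : R) x = pd k (fun y => H y 0 1 : R) x.
  exact: (eq_pd _ oU Ux).
rewrite (pd_det 0 Ux) (pd_det 1 Ux) /christ_trace.
have [i00 i01 i10 i11] := invmx22 (detH Ux).
rewrite !christE (S 0) (S 1) i00 i01 i10 i11 (symH Ux); have := detH Ux.
rewrite det22 (symH Ux).
repeat match goal with
| |- context [pd ?k ?f x] => generalize (pd k f x); intro
| |- context [H x ?k ?l] => generalize (H x k l); intro
end.
by move=> d0; split; field.
Qed.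

Lemma pdv_cof_grad0 x : U x -> pdv 0 cof_grad0 x =
  pd 0 (fun y => H y 1 1 : R) x *: pdv 0 nu x + H x 1 1 *: pdv 0 (pdv 0 nu) x
  - (pd 0 (fun y => H y 0 1 : R) x *: pdv 1 nu x + H x 0 1 *: pdv 0 (pdv 1 nu) x).
Proof.
move=> Ux; have s0 := vsmooth_pdv 0 snu; have s1 := vsmooth_pdv 1 snu.
apply: etrans (pdvD _ Ux (vsmoothZ oU (sH 1 1) s0)
  (vsmoothN oU (vsmoothZ oU (sH 0 1) s1))) _.
apply: (f_equal2 +%R); first exact: (pdvZ 0 Ux (sH 1 1) s0).
apply: etrans (pdvN 0 Ux (vsmoothZ oU (sH 0 1) s1)) _.
exact: (congr1 -%R (pdvZ 0 Ux (sH 0 1) s1)).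
Qed.

Lemma pdv_cof_grad1 x : U x -> pdv 1 cof_grad1 x =
  pd 1 (fun y => H y 0 0 : R) x *: pdv 1 nu x + H x 0 0 *: pdv 1 (pdv 1 nu) x
  - (pd 1 (fun y => H y 0 1 : R) x *: pdv 0 nu x + H x 0 1 *: pdv 1 (pdv 0 nu) x).
Proof.
move=> Ux; have s0 := vsmooth_pdv 0 snu; have s1 := vsmooth_pdv 1 snu.
apply: etrans (pdvD _ Ux (vsmoothZ oU (sH 0 0) s1)
  (vsmoothN oU (vsmoothZ oU (sH 0 1) s0))) _.
apply: (f_equal2 +%R); first exact: (pdvZ 1 Ux (sH 0 0) s1).
apply: etrans (pdvN 1 Ux (vsmoothZ oU (sH 0 1) s0)) _.
exact: (congr1 -%R (pdvZ 1 Ux (sH 0 1) s0)).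
Qed.

(** The first-order terms produced by [christ_traceE] complete the second derivatives
    of [nu] to derivatives of the fields [cof_grad0] and [cof_grad1]. *)
Lemma tension_divergence x : U x -> \det (H x) *: vtension x =
  proj (nu x) (pdv 0 cof_grad0 x + pdv 1 cof_grad1 x
    - (pd 0 (fun y => \det (H y)) x / (2 * \det (H x))) *: cof_grad0 x
    - (pd 1 (fun y => \det (H y)) x / (2 * \det (H x))) *: cof_grad1 x).
Proof.
move=> Ux.
apply: etrans (congr1 (fun v => \det (H x) *: v) (proj_comb _ _ _ _ _)) _.
apply: etrans (esym (projZ _ _ _)) _.
apply: (congr1 (proj (nu x))).
rewrite -/(christ_trace 0 x) -/(christ_trace 1 x).
have [t0 t1] := christ_traceE Ux.
have [i00 i01 i10 i11] := invmx22 (detH Ux).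
rewrite i00 i01 i10 i11 (symH Ux).
rewrite pdv_cof_grad0 // pdv_cof_grad1 // (pdv_comm oU 1 0 Ux snu).
rewrite /cof_grad0 /cof_grad1.
move: t0 t1 (detH Ux).
generalize (christ_trace 0 x) (christ_trace 1 x).
generalize (\det (H x)); generalize (fun y => \det (H y)).
move=> dd d c0 c1.
repeat match goal with
| |- context [pdv ?k ?f x] => generalize (pdv k f x); intro
| |- context [pd ?k ?f x] => generalize (pd k f x); intro
| |- context [H x ?k ?l] => generalize (H x k l); intro
end.
move=> t0 t1 d0.
have -> : c0 = (d * c0) / d by field.
have -> : c1 = (d * c1) / d by field.
by rewrite t0 t1; apply: vecP; rewrite !mxE; field.
Qed.

End TensionDivergence.

(** * Moving frames and the Gauss equation *)

(** The data left of an immersion into SU(2) after left translation to su(2):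
    [A k] is f^-1 f_k and [nu] is f^-1 n.  The condition [frame_structure] is the
    Maurer-Cartan equation of SU(2), the Lie bracket of su(2) being twice the cross
    product. *)
Record moving_frame (R : realType) (U : set 'rV[R]_2)
    (A : 'I_2 -> 'rV[R]_2 -> 'rV[R]_3) (nu : 'rV[R]_2 -> 'rV[R]_3) : Prop := {
  frame_smooth : forall k, vsmooth U (A k);
  normal_smooth : vsmooth U nu;
  normal_unit : forall y, U y -> dot (nu y) (nu y) = 1;
  frame_tangent : forall k y, U y -> dot (A k y) (nu y) = 0;
  frame_structure : forall y, U y ->
    pdv 0 (A 1) y - pdv 1 (A 0) y = (- 2) *: cross (A 0 y) (A 1 y);
  frame_free : forall y, U y -> det3 (A 0 y) (A 1 y) (nu y) != 0 }.

Section MovingFrame.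
Variable R : realType.
Notation vec := 'rV[R]_3.
Notation plane := 'rV[R]_2.
Variables (U : set plane) (A : 'I_2 -> plane -> vec) (nu : plane -> vec).
Hypothesis oU : open U.
Hypothesis frA : moving_frame U A nu.
Let sA := frame_smooth frA.
Let snu := normal_smooth frA.
Let nu1 := normal_unit frA.
Let A_nu := frame_tangent frA.
Let A_struct := frame_structure frA.
Let A_free := frame_free frA.
Implicit Types (k l m : 'I_2) (x y : plane).

(** This is f^-1 n_l: the derivative of [nu] does not see that f itself moves, and the
    cross product restores the missing term. *)
Definition dnormal l y : vec := pdv l nu y + cross (A l y) (nu y).
Definition area y : R := det3 (A 0 y) (A 1 y) (nu y).
Definition extrinsic_curvature y : R :=
  det3 (dnormal 0 y) (dnormal 1 y) (nu y) / area y.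

Lemma pd_cst_on (f : plane -> R) (c : R) k y : U y -> (forall z, U z -> f z = c) ->
  pd k f y = 0.
Proof.
move=> Uy fc; rewrite (@eq_pd _ U k f (fun=> c) y oU Uy fc).
exact: derive_cst.
Qed.

Lemma dnu_tangent l y : U y -> dot (pdv l nu y) (nu y) = 0.
Proof.
move=> Uy; have := pd_cst_on l Uy nu1.
rewrite (pd_dot oU _ Uy snu snu) (dotC (nu y)) => /eqP.
by rewrite -mulr2n mulrn_eq0 => /eqP.
Qed.

Lemma dnormal_tangent l y : U y -> dot (dnormal l y) (nu y) = 0.
Proof. by move=> Uy; rewrite /dnormal dotDl dnu_tangent // dot_crossr addr0. Qed.

Lemma dA_nu k l y : U y -> dot (pdv l (A k) y) (nu y) = - dot (A k y) (pdv l nu y).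
Proof.
move=> Uy; have := pd_cst_on l Uy (fun z => @A_nu k z).
rewrite (pd_dot oU _ Uy (sA k) snu) => /eqP; rewrite addr_eq0 => /eqP; exact.
Qed.

(** Differentiating the orthogonality of the frame and [nu] trades the derivatives of
    [nu] for those of the frame, whose antisymmetric part is prescribed. *)
Lemma dnormal_sym01 y : U y -> dot (A 0 y) (dnormal 1 y) = dot (A 1 y) (dnormal 0 y).
Proof.
move=> Uy; have := congr1 (fun v => dot v (nu y)) (A_struct Uy).
rewrite /= dotBl dotZl !dA_nu // /dnormal !dotDr.
rewrite (dotC (A 0 y) (cross _ _)) (dotC (A 1 y) (cross _ _)).
rewrite !(dot_cross_cycle (A _ y) (nu y)) !(dot_cross_cycle (nu y)).
rewrite (crossC (A 1 y)) dotNl; set p := dot (cross _ _) _.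
set q := dot (A 0 y) _; set r := dot (A 1 y) _.
by move=> E; lra.
Qed.

Lemma dnormal_sym k l y : U y -> dot (A k y) (dnormal l y) = dot (A l y) (dnormal k y).
Proof.
move=> Uy; have T := dnormal_sym01 Uy.
by move: k l; apply: ord2P; apply: ord2P;
  [exact: erefl | exact: T | exact: esym T | exact: erefl].
Qed.

Lemma extrinsic_curvatureK y : U y ->
  extrinsic_curvature y * area y = det3 (dnormal 0 y) (dnormal 1 y) (nu y).
Proof. by move=> Uy; rewrite /extrinsic_curvature divfK // A_free. Qed.

(** The Gauss map multiplies areas by the curvature, see [gauss_equation]. *)
Lemma det3_dnu y : U y -> det3 (pdv 0 nu y) (pdv 1 nu y) (nu y)
  = (1 + extrinsic_curvature y) * area y.
Proof.
move=> Uy; rewrite mulrDl mul1r extrinsic_curvatureK // addrC.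
have E l : pdv l nu y = dnormal l y - 1 *: cross (A l y) (nu y).
  by rewrite scale1r /dnormal addrK.
rewrite (E 0) (E 1) (det3_pencil (nu1 Uy)) ?mul1r ?A_nu ?dnormal_tangent //.
exact: dnormal_sym01.
Qed.

Section Gauss.
Variable G : plane -> 'M[R]_2.
Hypothesis G_gram : forall k l y, U y -> G y k l = dot (A k y) (A l y).

Let G_smooth k l : smooth_on U (fun y => G y k l : R).
Proof.
apply: eq_smooth_on (smooth_dot oU (sA k) (sA l)) => // y Uy.
by rewrite G_gram.
Qed.

Let G_sym y : U y -> G y 1 0 = G y 0 1.
Proof. by move=> Uy; rewrite !G_gram // dotC. Qed.

Lemma det_metric y : U y -> \det (G y) = area y * area y.
Proof.
move=> Uy; rewrite det22 !G_gram // (dotC (A 1 y) (A 0 y)).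
exact: (det_gram (nu1 Uy)) (A_nu 0 Uy) (A_nu 1 Uy).
Qed.

Let G_det y : U y -> \det (G y) != 0.
Proof. by move=> Uy; rewrite det_metric // mulf_neq0 // A_free. Qed.

Lemma pd_metric k l m y : U y -> pd m (fun z => G z k l : R) y
  = dot (pdv m (A k) y) (A l y) + dot (A k y) (pdv m (A l) y).
Proof.
move=> Uy; rewrite -(pd_dot oU _ Uy (sA k) (sA l)).
by apply: (eq_pd _ oU Uy) => z Uz; rewrite G_gram.
Qed.

(** The Maurer-Cartan equation makes the antisymmetric part of the derivatives of the
    frame normal, hence invisible to tangent vectors. *)
Lemma torsion_free k l m y : U y ->
  dot (pdv k (A l) y) (A m y) = dot (pdv l (A k) y) (A m y).
Proof.
move=> Uy.
have T n : dot (pdv 0 (A 1) y) (A n y) = dot (pdv 1 (A 0) y) (A n y).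
  apply/eqP; rewrite -subr_eq0 -dotBl A_struct // dotZl.
  by move: n; apply: ord2P; rewrite ?dot_crossl ?dot_crossr mulr0.
by move: k l; apply: ord2P; apply: ord2P;
  [exact: erefl | exact: T | exact: esym (T _) | exact: erefl].
Qed.

(** The tangential part of the derivative of the frame is compatible with the metric
    and torsion free, so the Koszul formula identifies it with the Levi-Civita
    connection. *)
Lemma christ_frame k l m y : U y ->
  \sum_s christ G k l s y * G y s m = dot (pdv k (A l) y) (A m y).
Proof.
move=> Uy; rewrite (christ_lower G_sym G_det) // !pd_metric //.
rewrite (dotC (A l y)) (dotC (A k y) (pdv l _ _)) (dotC (A k y) (pdv m _ _)).
rewrite (torsion_free m k _ Uy) (torsion_free l k _ Uy) (torsion_free m l _ Uy).
by field.
Qed.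

Lemma frame_normal y (w : vec) : U y -> dot w (A 0 y) = 0 -> dot w (A 1 y) = 0 ->
  w = dot w (nu y) *: nu y.
Proof.
move=> Uy w0 w1; have := cross_cross w (A 0 y) (A 1 y).
rewrite w0 w1 !scale0r subr0 (cross_tangent (nu1 Uy) (A_nu 0 Uy) (A_nu 1 Uy)) crossZr.
move/eqP; rewrite scaler_eq0 (negbTE (A_free Uy)) /= => /eqP wn.
have := cross_cross (nu y) w (nu y).
rewrite wn cross0r nu1 // scale1r dotC => /esym/eqP.
by rewrite subr_eq0 => /eqP.
Qed.

(** Lower the last index of the curvature by the metric.  Differentiating
    [christ_frame] produces third-order terms that cancel because derivatives commute;
    what remains pairs the parts of the derivatives of the frame that are not
    tangential ([N]).  These are multiples of [nu] with coefficients given by the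
    derivatives of [nu], and they combine to the area spanned by the latter. *)
Lemma gauss_equation y : U y ->
  \sum_m (pd 0 (christ G 1 1 m) y - pd 1 (christ G 0 1 m) y
    + \sum_s (christ G 1 1 s y * christ G 0 s m y
              - christ G 0 1 s y * christ G 1 s m y)) * G y m 0
  = (1 + extrinsic_curvature y) * \det (G y).
Proof.
move=> Uy; have low := christ_frame.
have d k l m n : pd n (fun z => \sum_s christ G k l s z * G z s m) y =
    \sum_s (pd n (christ G k l s) y * G y s m
      + christ G k l s y * pd n (fun z => G z s m : R) y).
  have dC s : derivable (christ G k l s) y (delta_mx 0 n).
    exact: smooth_on_derivable (smooth_christ oU G_smooth G_det _ _ _) Uy.
  have dG s : derivable (fun z => G z s m : R) y (delta_mx 0 n).
    exact: smooth_on_derivable (G_smooth _ _) Uy.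
  have dP s : derivable (fun z => christ G k l s z * G z s m) y (delta_mx 0 n).
    apply: smooth_on_derivable (smooth_onM oU _ (G_smooth _ _)) Uy.
    exact: smooth_christ.
  under [X in pd n X]funext do rewrite sum2.
  by rewrite (pdD (dP 0) (dP 1)) sum2 (pdM (dC 0) (dG 0)) (pdM (dC 1) (dG 1)).
have e k l m n : \sum_s (pd n (christ G k l s) y * G y s m
      + christ G k l s y * pd n (fun z => G z s m : R) y)
    = dot (pdv n (pdv k (A l)) y) (A m y) + dot (pdv k (A l) y) (pdv n (A m) y).
  rewrite -d -(pd_dot oU _ Uy (vsmooth_pdv k (sA l)) (sA m)).
  by apply: (eq_pd _ oU Uy) => z Uz; rewrite low.
have N k l : pdv k (A l) y - \sum_s christ G k l s y *: A s y
    = - dot (A l y) (pdv k nu y) *: nu y.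
  have O m : dot (pdv k (A l) y - \sum_s christ G k l s y *: A s y) (A m y) = 0.
    rewrite dotBl -low // !sum2 dotDl !dotZl !G_gram //.
    by rewrite subrr.
  rewrite (frame_normal Uy (O 0) (O 1)) dotBl dA_nu // sum2 dotDl !dotZl !A_nu //.
  by rewrite !mulr0 addr0 subr0.
(* The normal parts [N], paired with a vector that is differentiated as well. *)
have K k l v : dot (pdv k (A l) y) v
    - (christ G k l 0 y * dot (A 0 y) v + christ G k l 1 y * dot (A 1 y) v)
    = - dot (A l y) (pdv k nu y) * dot (nu y) v.
  by rewrite -(dotZl _ (nu y)) -N dotBl sum2 dotDl !dotZl.
have := e 1 1 0 0; have := e 0 1 0 1.
have := K 1 1 (pdv 0 (A 0) y); have := K 0 1 (pdv 1 (A 0) y).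
rewrite (dotC (nu y)) (dotC (nu y)) !(dA_nu _ _ Uy).
rewrite (pdv_comm oU 0 1 Uy (sA 1)) !sum2 !(pd_metric _ _ _ Uy).
have := low 0 0 0 y Uy; have := low 0 1 0 y Uy.
have := low 1 0 0 y Uy; have := low 1 1 0 y Uy; rewrite !sum2.
have -> : (1 + extrinsic_curvature y) * \det (G y)
  = dot (A 0 y) (pdv 0 nu y) * dot (A 1 y) (pdv 1 nu y)
    - dot (A 0 y) (pdv 1 nu y) * dot (A 1 y) (pdv 0 nu y).
  rewrite -dot_cross_cross (cross_tangent (nu1 Uy) (A_nu 0 Uy) (A_nu 1 Uy)).
  rewrite (cross_tangent (nu1 Uy) (dnu_tangent 0 Uy) (dnu_tangent 1 Uy)).
  by rewrite dotZl dotZr nu1 // mulr1 det3_dnu // det_metric // /area; ring.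
(* Substituting the four lowered symbols, the claim is the difference of the two
   instances of [e] combined with the two instances of [K]. *)
clear e N K d low.
repeat match goal with
| |- context [dot ?u ?v] => generalize (dot u v); intro
| |- context [pd ?k ?f y] => generalize (pd k f y); intro
| |- context [christ G ?k ?l ?m y] => generalize (christ G k l m y); intro
| |- context [G y ?k ?l] => generalize (G y k l); intro
end.
move=> <- <- <- <- K01 K11 E01 E11.
clear -K01 K11 E01 E11; lra.
Qed.

End Gauss.

End MovingFrame.

(** * The tension of the normal for a multiple of the second form *)

Section FrameTension.
Variable R : realType.
Notation vec := 'rV[R]_3.
Notation plane := 'rV[R]_2.
Variables (U : set plane) (A : 'I_2 -> plane -> vec) (nu : plane -> vec).
Hypothesis oU : open U.
Hypothesis frA : moving_frame U A nu.
Let sA := frame_smooth frA.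
Let snu := normal_smooth frA.
Let nu1 := normal_unit frA.
Let A_nu := frame_tangent frA.
Let A_struct := frame_structure frA.
Let A_free := frame_free frA.
Implicit Types (k l m : 'I_2) (x y : plane).

Notation B := (dnormal A nu).
Notation kappa := (extrinsic_curvature A nu).
Notation area := (area A nu).
Notation C := (fun l y => cross (A l y) (nu y)).

Lemma smooth_dnormal l : vsmooth U (dnormal A nu l).
Proof.
by apply: vsmoothD; [exact: oU|exact: vsmooth_pdv|exact: vsmooth_cross].
Qed.

Lemma smooth_area : smooth_on U area.
Proof. by apply: smooth_dot => //; exact: vsmooth_cross. Qed.

Lemma smooth_extrinsic_curvature : smooth_on U kappa.
Proof.
apply: smooth_onM => //; last exact: smooth_onV smooth_area.
apply: smooth_dot => //; apply: vsmooth_cross => //; exact: smooth_dnormal.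
Qed.

Definition second_fundamental y : 'M[R]_2 := \matrix_(k, l) - dot (A k y) (B l y).

Lemma second_fundamental_sym y : U y ->
  second_fundamental y 1 0 = second_fundamental y 0 1.
Proof. by move=> Uy; rewrite !mxE (dnormal_sym01 oU frA Uy). Qed.

Lemma det_second_fundamental y : U y ->
  \det (second_fundamental y) = kappa y * (area y * area y).
Proof.
move=> Uy; rewrite det22 !mxE mulrA (extrinsic_curvatureK frA Uy) [RHS]mulrC.
rewrite -(det_sym_form (nu1 Uy) (A_nu 0 Uy) (A_nu 1 Uy)
  (dnormal_tangent oU frA 0 Uy) (dnormal_tangent oU frA 1 Uy)
  (dnormal_sym01 oU frA Uy)) -(dnormal_sym01 oU frA Uy) !mulrNN.
by [].
Qed.

Section Conformal.
Variables (lam : plane -> R) (H : plane -> 'M[R]_2).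
Hypothesis slam : smooth_on U lam.
Hypothesis lam0 : forall y, U y -> lam y != 0.
Hypothesis HE : forall y, U y -> H y = lam y *: second_fundamental y.
Hypothesis kappa0 : forall y, U y -> kappa y != 0.

(** Quarter turns of the vectors [B_l + kappa A_l x nu]: the index is rotated, which is
    the Hodge star of the surface in coordinates. *)
Definition dual0 y : vec := - B 1 y - kappa y *: cross (A 1 y) (nu y).
Definition dual1 y : vec := B 0 y + kappa y *: cross (A 0 y) (nu y).

Lemma cof_grad_dual y : U y ->
  cof_grad0 H nu y = (lam y * area y) *: dual0 y /\
  cof_grad1 H nu y = (lam y * area y) *: dual1 y.
Proof.
move=> Uy; have E l : pdv l nu y = B l y - cross (A l y) (nu y).
  by rewrite /dnormal addrK.
have [e0 e1] := cross_sym_form (nu1 Uy) (A_nu 0 Uy) (A_nu 1 Uy)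
  (dnormal_tangent oU frA 0 Uy) (dnormal_tangent oU frA 1 Uy)
  (dnormal_sym01 oU frA Uy) (extrinsic_curvatureK frA Uy).
rewrite -(E 0) -(E 1) in e0 e1.
have K (a b s : R) (X Y Z : vec) : - a *: X + b *: Y = s *: Z ->
    (lam y * - a) *: X - (lam y * - b) *: Y = (lam y * s) *: Z.
  by move=> e; rewrite -(scalerA _ s) -e; apply: vecP; rewrite !mxE; ring.
by rewrite /cof_grad0 /cof_grad1 (HE Uy) !mxE; split; apply: K.
Qed.

Lemma smoothH k l : smooth_on U (fun y => H y k l : R).
Proof.
have S := smooth_onM oU slam (smooth_onN oU (smooth_dot oU (sA k) (smooth_dnormal l))).
by apply: eq_smooth_on S => // y Uy; rewrite (HE Uy) !mxE.
Qed.

Lemma symH y : U y -> H y 1 0 = H y 0 1.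
Proof.
by move=> Uy; have := second_fundamental_sym Uy; rewrite (HE Uy) !mxE => ->.
Qed.

Lemma detHE y : U y -> \det (H y) = kappa y * ((lam y * area y) * (lam y * area y)).
Proof.
by move=> Uy; rewrite (HE Uy) detZ (det_second_fundamental Uy) expr2; ring.
Qed.

Lemma detH0 y : U y -> \det (H y) != 0.
Proof.
move=> Uy; have m0 : lam y * area y != 0 := mulf_neq0 (lam0 Uy) (A_free Uy).
by rewrite (detHE Uy); apply: mulf_neq0 (kappa0 Uy) (mulf_neq0 m0 m0).
Qed.

(** Since the derivatives of [nu] commute, d_0 B_1 - d_1 B_0 equals
    d_0 (A_1 x nu) - d_1 (A_0 x nu), which is a multiple of [nu] by the Maurer-Cartan
    equation.  Only the derivatives of [kappa] leave a tangential contribution. *)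
Lemma pdv_dual x : U x -> exists q,
  pdv 0 dual0 x + pdv 1 dual1 x = q *: nu x
    - pd 0 kappa x *: cross (A 1 x) (nu x) + pd 1 kappa x *: cross (A 0 x) (nu x).
Proof.
move=> Ux.
have sC l : vsmooth U (C l) by exact: (vsmooth_cross oU (sA l) snu).
have sB := smooth_dnormal; have sk := smooth_extrinsic_curvature.
have d0 : pdv 0 dual0 x = - pdv 0 (B 1) x - (pd 0 kappa x *: C 1 x
    + kappa x *: pdv 0 (C 1) x).
  apply: etrans (pdvD _ Ux (vsmoothN oU (sB 1)) (vsmoothN oU (vsmoothZ oU sk (sC 1)))) _.
  rewrite (pdvN _ Ux (sB 1)) (pdvN _ Ux (vsmoothZ oU sk (sC 1))).
  by rewrite (pdvZ _ Ux sk (sC 1)).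
have d1 : pdv 1 dual1 x = pdv 1 (B 0) x + (pd 1 kappa x *: C 0 x
    + kappa x *: pdv 1 (C 0) x).
  apply: etrans (pdvD _ Ux (sB 0) (vsmoothZ oU sk (sC 0))) _.
  by rewrite (pdvZ _ Ux sk (sC 0)).
have b0 : pdv 0 (B 1) x = pdv 0 (pdv 1 nu) x + pdv 0 (C 1) x.
  exact: pdvD _ Ux (vsmooth_pdv 1 snu) (sC 1).
have b1 : pdv 1 (B 0) x = pdv 1 (pdv 0 nu) x + pdv 1 (C 0) x.
  exact: pdvD _ Ux (vsmooth_pdv 0 snu) (sC 0).
have [q qE] : exists q, pdv 0 (C 1) x - pdv 1 (C 0) x = q *: nu x.
  have c0 : pdv 0 (C 1) x = cross (pdv 0 (A 1) x) (nu x) + cross (A 1 x) (pdv 0 nu x).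
    exact: (pdv_cross oU 0 Ux (sA 1) snu).
  have c1 : pdv 1 (C 0) x = cross (pdv 1 (A 0) x) (nu x) + cross (A 0 x) (pdv 1 nu x).
    exact: (pdv_cross oU 1 Ux (sA 0) snu).
  exists (det3 (A 1 x) (pdv 0 nu x) (nu x) - det3 (A 0 x) (pdv 1 nu x) (nu x)).
  rewrite c0 c1 opprD addrACA -crossNl -crossDl (A_struct Ux).
  rewrite (cross_tangent (nu1 Ux) (A_nu 0 Ux) (A_nu 1 Ux)) !crossZl crossvv.
  rewrite (cross_tangent (nu1 Ux) (A_nu 1 Ux) (dnu_tangent oU frA 0 Ux)).
  rewrite (cross_tangent (nu1 Ux) (A_nu 0 Ux) (dnu_tangent oU frA 1 Ux)).
  by rewrite !scaler0 add0r scalerBl.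
(* The antisymmetrized derivatives of the [B_l] contribute - q, and the products of
   [kappa] with the [A_l x nu] contribute - kappa q. *)
exists (- (1 + kappa x) * q).
have q0 : pdv 0 (C 1) x = q *: nu x + pdv 1 (C 0) x by rewrite -qE subrK.
rewrite d0 d1 b0 b1 (pdv_comm oU 1 0 Ux snu) q0.
clear.
repeat match goal with
| |- context [pdv ?k ?f x] => generalize (pdv k f x); intro
| |- context [pd ?k ?f x] => generalize (pd k f x); intro
| |- context [cross ?u ?v] => generalize (cross u v); intro
end.
by apply: vecP; rewrite !mxE; ring.
Qed.

Definition pencil l y : vec := B l y - kappa y *: cross (A l y) (nu y).

Lemma pencil_tangent l y : U y -> dot (pencil l y) (nu y) = 0.
Proof.
move=> Uy; rewrite dotBl dotZl dot_crossr mulr0 subr0.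
exact: (dnormal_tangent oU frA l Uy).
Qed.

(** In the divergence formula the derivatives of the factor [lam * area] cancel against
    its share of the logarithmic derivative of the determinant, since the latter is
    [kappa * (lam * area) ^+ 2]. *)
Lemma tension_formula x : U x -> \det (H x) *: vtension H nu x =
  (lam x * area x / (2 * kappa x)) *:
    (pd 0 kappa x *: pencil 1 x - pd 1 kappa x *: pencil 0 x).
Proof.
move=> Ux; pose mu y := lam y * area y.
have smu : smooth_on U mu by exact: smooth_onM slam smooth_area.
have mu0 : mu x != 0 := mulf_neq0 (lam0 Ux) (A_free Ux).
have sk := smooth_extrinsic_curvature.
have sB := smooth_dnormal.
have sC l : vsmooth U (C l) by exact: (vsmooth_cross oU (sA l) snu).
have s0 : vsmooth U dual0.
  exact (vsmoothD oU (vsmoothN oU (sB 1)) (vsmoothN oU (vsmoothZ oU sk (sC 1)))).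
have s1 : vsmooth U dual1.
  exact (vsmoothD oU (sB 0) (vsmoothZ oU sk (sC 0))).
rewrite (tension_divergence oU smoothH symH detH0 snu Ux).
have [c0 c1] := cof_grad_dual Ux.
have g0 : pdv 0 (cof_grad0 H nu) x = pd 0 mu x *: dual0 x + mu x *: pdv 0 dual0 x.
  rewrite -(pdvZ 0 Ux smu s0); apply: (eq_pdv oU _ Ux) => y Uy.
  by have [-> _] := cof_grad_dual Uy.
have g1 : pdv 1 (cof_grad1 H nu) x = pd 1 mu x *: dual1 x + mu x *: pdv 1 dual1 x.
  rewrite -(pdvZ 1 Ux smu s1); apply: (eq_pdv oU _ Ux) => y Uy.
  by have [_ ->] := cof_grad_dual Uy.
have dD k : pd k (fun y => \det (H y)) x
    = pd k kappa x * (mu x * mu x) + kappa x * (2 * mu x * pd k mu x).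
  have dmu := smooth_on_derivable (v := delta_mx 0 k) smu Ux.
  have dmm := smooth_on_derivable (v := delta_mx 0 k) (smooth_onM oU smu smu) Ux.
  have dk := smooth_on_derivable (v := delta_mx 0 k) sk Ux.
  rewrite (eq_pd k oU Ux (fun y Uy => detHE Uy)).
  apply: etrans (pdM dk dmm) _; rewrite (pdM dmu dmu).
  by congr (_ + _); ring.
have [q qE] := pdv_dual Ux.
have q0 : pdv 0 dual0 x = (q *: nu x - pd 0 kappa x *: cross (A 1 x) (nu x)
    + pd 1 kappa x *: cross (A 0 x) (nu x)) - pdv 1 dual1 x by rewrite -qE addrK.
(* [V] is tangent, so it can be put under the projection, together with a multiple of
   [nu] that absorbs the normal part of [pdv_dual]. *)
pose V : vec := (mu x / (2 * kappa x)) *: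
  (pd 0 kappa x *: pencil 1 x - pd 1 kappa x *: pencil 0 x).
have tV : dot V (nu x) = 0.
  by rewrite dotZl dotBl !dotZl !(pencil_tangent _ Ux) !mulr0 subrr mulr0.
rewrite -[RHS]/V -(proj_tangent tV) -[RHS]addr0.
rewrite -(proj_normal (mu x * q) (nu1 Ux)) -projD.
apply: (congr1 (proj (nu x))); rewrite /V.
rewrite g0 g1 c0 c1 q0 (dD 0) (dD 1) (detHE Ux) -/(mu x) /dual0 /dual1 /pencil.
move: mu0 (kappa0 Ux); clear.
generalize (mu x) (kappa x) => r c r0 c0.
repeat match goal with
| |- context [pdv ?k ?f x] => generalize (pdv k f x); intro
| |- context [pd ?k ?f x] => generalize (pd k f x); intro
| |- context [cross ?u ?v] => generalize (cross u v); intro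
| |- context [dnormal ?u ?v ?l x] => generalize (dnormal u v l x); intro
end.
by apply: vecP; rewrite !mxE; field; rewrite r0 c0.
Qed.

(** The vectors [pencil 0] and [pencil 1] span the area
    [kappa * (1 + kappa) * area], so only the factor [1 + kappa], the Gauss curvature,
    can prevent the derivatives of [kappa] from vanishing. *)
Lemma tension_eq0_curvature x : U x -> vtension H nu x = 0 -> forall l,
  pd l kappa x * (1 + kappa x) = 0.
Proof.
move=> Ux t0; have := tension_formula Ux; rewrite t0 scaler0 => /esym/eqP.
have m0 : lam x * area x / (2 * kappa x) != 0.
  apply: mulf_neq0; first exact: mulf_neq0 (lam0 Ux) (A_free Ux).
  by rewrite invr_eq0 mulf_neq0 // ?pnatr_eq0 // kappa0.
rewrite scaler_eq0 (negbTE m0) /= => /eqP e.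
have D : det3 (pencil 0 x) (pencil 1 x) (nu x) = kappa x * (1 + kappa x) * area x.
  rewrite (det3_pencil (nu1 Ux) (dnormal_tangent oU frA 0 Ux)
    (dnormal_tangent oU frA 1 Ux) (dnormal_sym01 oU frA Ux)).
  by rewrite -(extrinsic_curvatureK frA Ux) -[det3 (A 0 x) _ _]/(area x); ring.
have ka0 : kappa x * area x != 0 := mulf_neq0 (kappa0 Ux) (A_free Ux).
have E0 : pd 0 kappa x * det3 (pencil 0 x) (pencil 1 x) (nu x) = 0.
  have := congr1 (fun v => det3 (pencil 0 x) v (nu x)) e.
  by rewrite /det3 /= crossDr crossNr !crossZr crossvv scaler0 subr0 cross0r dotZl dot0l.
have E1 : pd 1 kappa x * det3 (pencil 0 x) (pencil 1 x) (nu x) = 0.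
  have := congr1 (fun v => det3 v (pencil 1 x) (nu x)) e.
  rewrite /det3 /= crossDl crossNl !crossZl crossvv scaler0 sub0r (crossC 0) cross0r.
  by rewrite oppr0 dot0l dotNl dotZl => /eqP; rewrite oppr_eq0 => /eqP.
apply: ord2P; apply: (mulIf ka0); rewrite mul0r.
- by rewrite -E0 D; ring.
- by rewrite -E1 D; ring.
Qed.

Lemma curvature_tension_eq0 x : U x -> (forall l, pd l kappa x = 0) ->
  vtension H nu x = 0.
Proof.
move=> Ux k0; have := tension_formula Ux.
rewrite !k0 !scale0r subrr scaler0 => /eqP.
by rewrite scaler_eq0 (negbTE (detH0 Ux)) /= => /eqP.
Qed.

End Conformal.
End FrameTension.

(** * Quaternions *)

Section Quaternions.
Local Open Scope complex_scope.
Local Open Scope sesquilinear_scope.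
Variable R : realType.
Notation vec := 'rV[R]_3.
Notation mat := 'M[R[i]]_2.
Implicit Types (a b c : R) (u v w : vec) (z : R[i]) (X Y : mat).

Lemma cplxP z z' : complex.Re z = complex.Re z' -> complex.Im z = complex.Im z' ->
  z = z'.
Proof. by case: z z' => [x y] [x' y'] /= -> ->. Qed.

Lemma ReIm_simpl : (forall a b, complex.Re (a +i* b) = a) *
  (forall a b, complex.Im (a +i* b) = b) *
  (forall z z', complex.Re (z + z') = complex.Re z + complex.Re z') *
  (forall z z', complex.Im (z + z') = complex.Im z + complex.Im z') *
  (forall z z', complex.Re (z * z') =
     complex.Re z * complex.Re z' - complex.Im z * complex.Im z') *
  (forall z z', complex.Im (z * z') =
     complex.Re z * complex.Im z' + complex.Im z * complex.Re z') *
  (forall z, complex.Re (- z) = - complex.Re z) *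
  (forall z, complex.Im (- z) = - complex.Im z) *
  (forall z, complex.Re (Num.conj z) = complex.Re z) *
  (forall z, complex.Im (Num.conj z) = - complex.Im z) *
  (forall a, complex.Re a%:C = a) * (forall a, complex.Im a%:C = 0).
Proof. by do ![split] => // -[x y] //= [x' y']. Qed.

(** The quaternion with real part [a] and vector part [u], as a complex matrix.  With
    [a = 0] this is su(2), with norm one it is SU(2); matrix and quaternion products
    agree ([quatM]) and conjugation is the adjoint ([quat_conj]). *)
Definition quat a u : mat := \matrix_(i, j)
  if i == 0 then
    if j == 0 then a +i* u 0 (inord 0) else u 0 (inord 1) +i* u 0 (inord 2)
  else
    if j == 0 then (- u 0 (inord 1)) +i* u 0 (inord 2) else a -i* u 0 (inord 0).

Lemma quat00 a u : quat a u 0 0 = a +i* u 0 (inord 0).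
Proof. by rewrite mxE. Qed.
Lemma quat01 a u : quat a u 0 1 = u 0 (inord 1) +i* u 0 (inord 2).
Proof. by rewrite mxE. Qed.
Lemma quat10 a u : quat a u 1 0 = (- u 0 (inord 1)) +i* u 0 (inord 2).
Proof. by rewrite mxE. Qed.
Lemma quat11 a u : quat a u 1 1 = a -i* u 0 (inord 0).
Proof. by rewrite mxE. Qed.
Definition quatE := (quat00, quat01, quat10, quat11).

Definition vpart X : vec :=
  vec3 (complex.Im (X 0 0)) (complex.Re (X 0 1)) (complex.Im (X 0 1)).

Lemma vpart_quat a u : vpart (quat a u) = u.
Proof. by rewrite /vpart !quatE -vec3E. Qed.

Lemma quat_inj a b u v : quat a u = quat b v -> a = b /\ u = v.
Proof.
move=> e; split; last by rewrite -(vpart_quat a u) e vpart_quat.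
by have := congr1 (fun X : mat => complex.Re (X 0 0)) e; rewrite /= !quatE.
Qed.

Lemma mat2P X Y : X 0 0 = Y 0 0 -> X 0 1 = Y 0 1 -> X 1 0 = Y 1 0 ->
  X 1 1 = Y 1 1 -> X = Y.
Proof. by move=> *; apply/matrixP; apply: ord2P; apply: ord2P. Qed.

Lemma quatM a b u v : quat a u *m quat b v =
  quat (a * b - dot u v) (a *: v + b *: u + cross u v).
Proof.
by rewrite crossE dotE; apply: mat2P; rewrite [RHS]quatE [LHS]mxE sum2 !quatE;
  apply: cplxP; rewrite !ReIm_simpl ?coordE; ring.
Qed.

Lemma quatD a b u v : quat a u + quat b v = quat (a + b) (u + v).
Proof.
by apply: mat2P; rewrite [RHS]quatE [LHS]mxE !quatE; apply: cplxP;
  rewrite !ReIm_simpl ?mxE; ring.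
Qed.

Lemma quatN a u : - quat a u = quat (- a) (- u).
Proof.
by apply: mat2P; rewrite [RHS]quatE [LHS]mxE !quatE; apply: cplxP;
  rewrite !ReIm_simpl ?mxE; ring.
Qed.

Lemma quatZ c a u : c%:C *: quat a u = quat (c * a) (c *: u).
Proof.
by apply: mat2P; rewrite [RHS]quatE [LHS]mxE !quatE; apply: cplxP;
  rewrite !ReIm_simpl ?mxE; ring.
Qed.

Lemma quat_conj a u : (quat a u) ^t* = quat a (- u).
Proof.
by apply: mat2P; rewrite [RHS]quatE !mxE /=; apply: cplxP;
  rewrite !ReIm_simpl ?mxE; ring.
Qed.

Lemma quat_tr a u : \tr (quat a u) = (2 * a)%:C.
Proof. by rewrite /mxtrace sum2 !quatE; apply: cplxP; rewrite !ReIm_simpl; ring. Qed.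

Lemma quat_one : quat 1 0 = 1%:M.
Proof.
by apply: mat2P; rewrite [LHS]quatE !mxE /=; apply: cplxP; rewrite ?oppr0.
Qed.

Lemma quat_zero : quat 0 0 = 0 :> 'M[R[i]]_2.
Proof.
apply: etrans (scale0r (quat 0 0)); apply: etrans (esym (quatZ 0 0 0)).
by rewrite mul0r scale0r.
Qed.

Lemma dot_su2_quat a b u v : dot_su2 (quat a u) (quat b v) = dot u v - a * b.
Proof.
by rewrite /dot_su2 quatM quat_tr !ReIm_simpl; field.
Qed.

Lemma proj_S2_quat u v : proj_S2 (quat 0 u) (quat 0 v) = quat 0 (proj u v).
Proof.
rewrite /proj_S2 dot_su2_quat mulr0 subr0 quatZ quatN quatD mulr0 subr0.
by [].
Qed.

Lemma su2_quat X : su2 X -> X = quat 0 (vpart X).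
Proof.
move=> [Xa Xt]; have e i j : Num.conj (X j i) = - X i j.
  by have := congr1 (fun Y : mat => Y i j) Xa; rewrite !mxE.
move: Xt; rewrite /mxtrace sum2 => Xt.
have E11 : X 1 1 = - X 0 0 by apply/eqP; rewrite -addr_eq0 addrC Xt.
have e00 : complex.Re (X 0 0) = 0.
  have := congr1 (@complex.Re R) (e 0 0); rewrite !ReIm_simpl => ?; lra.
have r10 : complex.Re (X 1 0) = - complex.Re (X 0 1).
  have := congr1 (@complex.Re R) (e 0 1); rewrite !ReIm_simpl => ?; lra.
have i10 : complex.Im (X 1 0) = complex.Im (X 0 1).
  have := congr1 (@complex.Im R) (e 0 1); rewrite !ReIm_simpl => ?; lra.
by apply: mat2P; rewrite [RHS]quatE /vpart ?vec3_0 ?vec3_1 ?vec3_2 ?E11;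
  apply: cplxP; rewrite !ReIm_simpl ?e00 ?oppr0.
Qed.

Definition rpart X : R := complex.Re (X 0 0).

Lemma rpart_quat a u : rpart (quat a u) = a.
Proof. by rewrite /rpart quat00. Qed.

(** For determinant one the adjugate is the inverse, which is the adjoint for a unitary
    matrix; comparing entries gives the shape of a quaternion. *)
Lemma SU2_quat X : SU2 X -> X = quat (rpart X) (vpart X) /\
  rpart X * rpart X + dot (vpart X) (vpart X) = 1.
Proof.
move=> [/unitarymxP Xu dX].
have adjE : \adj X = X ^t*.
  rewrite -[LHS]mulmx1 -Xu mulmxA mul_adj_mx dX mul1mx.
  by [].
have l01 : lift 0 0 = 1 :> 'I_2 by apply: val_inj.
have l10 : lift 1 0 = 0 :> 'I_2 by apply: val_inj.
have E11 : X 1 1 = Num.conj (X 0 0).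
  have := congr1 (fun Y : mat => Y 0 0) adjE.
  by rewrite /adjugate /cofactor !mxE det_mx11 !mxE l01 expr0 mul1r.
have E10 : X 1 0 = - Num.conj (X 0 1).
  have := congr1 (fun Y : mat => Y 1 0) adjE.
  rewrite /adjugate /cofactor !mxE det_mx11 !mxE l01 l10 expr1 mulN1r => <-.
  by rewrite opprK.
have XE : X = quat (rpart X) (vpart X).
  by apply: mat2P; rewrite [RHS]quatE /vpart ?vec3_0 ?vec3_1 ?vec3_2 ?E11 ?E10;
    apply: cplxP; rewrite !ReIm_simpl ?opprK.
split; first exact: XE.
move: (vpart X) (rpart X) XE Xu => u a -> {X dX adjE E11 E10}.
rewrite quat_conj quatM -quat_one => /quat_inj[+ _].
by rewrite dotNr opprK.
Qed.

End Quaternions.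

(** * The frame of a surface in the three-sphere *)

Section SphereChart.
Local Open Scope complex_scope.
Local Open Scope sesquilinear_scope.
Variable R : realType.
Notation vec := 'rV[R]_3.
Notation plane := 'rV[R]_2.
Notation mat := 'M[R[i]]_2.
Variable U : set plane.
Hypothesis oU : open U.
Implicit Types (F G : plane -> mat) (x y : plane) (k l : 'I_2).

Lemma eq_pd_mx k F G y : U y -> (forall z, U z -> F z = G z) ->
  pd_mx k F y = pd_mx k G y.
Proof.
move=> Uy FG; apply/matrixP => i j; rewrite !mxE.
by congr (_ +i* _); apply: (eq_pd _ oU Uy) => z Uz; rewrite FG.
Qed.

(** The second row of a quaternion repeats the first up to sign, and real derivatives
    commute with signs only where they exist: hence the smoothness hypotheses. *)
Lemma pd_mx_quat k (a : plane -> R) (u : plane -> vec) y : U y ->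
  smooth_on U a -> vsmooth U u ->
  pd_mx k (fun z => quat (a z) (u z)) y = quat (pd k a y) (pdv k u y).
Proof.
move=> Uy sa su.
have pN j : pd k (fun z => - u z 0 j) y = - pd k (fun z => u z 0 j : R) y.
  by rewrite pdN //; exact: smooth_on_derivable (su j) Uy.
have E i j : pd_mx k (fun z => quat (a z) (u z)) y i j =
    pd k (fun z => complex.Re (quat (a z) (u z) i j) : R) y
    +i* pd k (fun z => complex.Im (quat (a z) (u z) i j) : R) y by rewrite mxE.
have aN : pd k (fun z => - u z 0 (inord 0)) y = - pd k (fun z => u z 0 (inord 0) : R) y.
  exact: pN.
apply: mat2P; rewrite [RHS]quatE E; apply: cplxP; rewrite !ReIm_simpl ?pdvE -?pN;
  apply: (eq_pd _ oU Uy) => z Uz; by rewrite quatE ReIm_simpl.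
Qed.

Lemma smooth_rpart F : smooth_mx_on U F -> smooth_on U (fun y => rpart (F y)).
Proof. by move=> sF; have [] := sF 0 0. Qed.

Lemma smooth_vpart F : smooth_mx_on U F -> vsmooth U (fun y => vpart (F y)).
Proof.
move=> sF; have [_ s0] := sF 0 0; have [s1 s2] := sF 0 1.
by apply: ord3P; [apply: eq_smooth_on s0|apply: eq_smooth_on s1|apply: eq_smooth_on s2]
  => // y _; rewrite !coordE.
Qed.

Variables F N : plane -> mat.
Hypothesis sF : smooth_mx_on U F.
Hypothesis sN : smooth_mx_on U N.
Hypothesis FSU2 : forall y, SU2 (F y).
Hypothesis Nsu2 : forall y, su2 (invmx (F y) *m N y).
Hypothesis N_unit : forall y, metric_SU2 (F y) (N y) (N y) = 1.
Hypothesis N_orth : forall k y, U y -> metric_SU2 (F y) (pd_mx k F y) (N y) = 0.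

Let a y : R := rpart (F y).
Let u y : vec := vpart (F y).

(** The vector part of F^-1 F_k.  Its real part is half the derivative of the squared
    norm of F, which is one, so that nothing is lost. *)
Definition left_frame k y : vec :=
  a y *: pdv k u y - pd k a y *: u y - cross (u y) (pdv k u y).

Definition left_normal y : vec := vpart (invmx (F y) *m N y).

Notation A := left_frame.
Notation nu := left_normal.

Let sa : smooth_on U a. Proof. exact: smooth_rpart. Qed.
Let su : vsmooth U u. Proof. exact: smooth_vpart. Qed.

Let FE y : F y = quat (a y) (u y).
Proof. by have [] := SU2_quat (FSU2 y). Qed.

Let F_unit y : a y * a y + dot (u y) (u y) = 1.
Proof. by have [] := SU2_quat (FSU2 y). Qed.

Let invF y : invmx (F y) = quat (a y) (- u y).
Proof. by have [Fu _] := FSU2 y; rewrite invmx_unitary // FE quat_conj. Qed.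

Lemma left_normalE y : invmx (F y) *m N y = quat 0 (nu y).
Proof. exact: su2_quat. Qed.

Let pdF k y : U y -> pd_mx k F y = quat (pd k a y) (pdv k u y).
Proof.
move=> Uy; rewrite -(pd_mx_quat k Uy sa su); apply: eq_pd_mx => // z _; exact: FE.
Qed.

Let pd_unit k y : U y -> a y * pd k a y + dot (u y) (pdv k u y) = 0.
Proof.
move=> Uy.
have e : pd k (fun z => a z * a z + dot (u z) (u z)) y = 0.
  rewrite (@eq_pd _ U k _ (fun=> 1) y oU Uy) => [|z _]; last exact: F_unit.
  exact: derive_cst.
have da := smooth_on_derivable (v := delta_mx 0 k) sa Uy.
have daa := smooth_on_derivable (v := delta_mx 0 k) (smooth_onM oU sa sa) Uy.
have duu := smooth_on_derivable (v := delta_mx 0 k) (smooth_dot oU su su) Uy.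
move: e; rewrite (pdD daa duu) (pdM da da) (pd_dot oU _ Uy su su).
rewrite (dotC (pdv k u y)); set p := _ * _; set q := dot _ _ => e.
by move: e; rewrite {}/p {}/q; lra.
Qed.

Lemma left_frameE k y : U y -> invmx (F y) *m pd_mx k F y = quat 0 (A k y).
Proof.
move=> Uy; rewrite invF pdF // quatM dotNl opprK pd_unit // /left_frame.
by rewrite scalerN crossNl.
Qed.

Let conjF k y : U y ->
  quat (pd k a y) (- pdv k u y) *m F y = - quat 0 (A k y).
Proof.
move=> Uy; rewrite FE quatM quatN oppr0 dotNl opprK; congr quat.
  by rewrite mulrC dotC pd_unit.
rewrite crossNl crossC opprK /left_frame scalerN.
clear; generalize (a y) (u y) (pdv k u y) (pd k a y) (cross (u y) (pdv k u y)).
by move=> *; apply: vecP; rewrite !mxE; ring.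
Qed.

(** Writing F^-1 F_k as minus the conjugate of F_k times F makes the middle factors of
    a product of two frame vectors cancel. *)
Let crossA k l y : U y -> cross (A k y) (A l y)
  = - (pd k a y *: pdv l u y - pd l a y *: pdv k u y - cross (pdv k u y) (pdv l u y)).
Proof.
move=> Uy; have e : quat 0 (A k y) *m quat 0 (A l y)
    = - (quat (pd k a y) (- pdv k u y) *m pd_mx l F y).
  transitivity (- (quat (pd k a y) (- pdv k u y) *m F y)
      *m (invmx (F y) *m pd_mx l F y)).
    by rewrite (conjF k Uy) (left_frameE l Uy) opprK.
  rewrite mulNmx -mulmxA mulKVmx //; apply: unitarymx_unit.
  by have [] := FSU2 y.
move: e; rewrite (pdF l Uy) !quatM quatN crossNl => /quat_inj[_].
have K (v w z v' w' z' : vec) (p q : R) : 0 *: v + 0 *: w + z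
    = - (p *: v' + q *: - w' + - z') -> z = - (p *: v' - q *: w' - z').
  by rewrite !scale0r !add0r scalerN.
exact: K.
Qed.

Let sP k := smooth_on_pd k sa.
Let sV k := vsmooth_pdv k su.

Lemma smooth_left_frame k : vsmooth U (A k).
Proof.
exact (vsmoothD oU (vsmoothD oU (vsmoothZ oU sa (sV k))
  (vsmoothN oU (vsmoothZ oU (sP k) su))) (vsmoothN oU (vsmooth_cross oU su (sV k)))).
Qed.

Let dA k l y : U y -> pdv k (A l) y =
  pd k a y *: pdv l u y + a y *: pdv k (pdv l u) y
  - (pd k (pd l a) y *: u y + pd l a y *: pdv k u y)
  - (cross (pdv k u y) (pdv l u y) + cross (u y) (pdv k (pdv l u) y)).
Proof.
move=> Uy.
apply: etrans (pdvD _ Uy (vsmoothD oU (vsmoothZ oU sa (sV l))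
  (vsmoothN oU (vsmoothZ oU (sP l) su))) (vsmoothN oU (vsmooth_cross oU su (sV l)))) _.
rewrite (pdvN _ Uy (vsmooth_cross oU su (sV l))) (pdv_cross oU k Uy su (sV l)).
congr (_ - _).
apply: etrans (pdvD _ Uy (vsmoothZ oU sa (sV l)) (vsmoothN oU (vsmoothZ oU (sP l) su))) _.
rewrite (pdvN _ Uy (vsmoothZ oU (sP l) su)).
by rewrite (pdvZ _ Uy sa (sV l)) (pdvZ _ Uy (sP l) su).
Qed.

Lemma smooth_left_normal : vsmooth U nu.
Proof.
have sb := smooth_rpart sN; have sw := smooth_vpart sN.
have NE y : N y = quat (rpart (N y)) (vpart (N y)).
  have -> : N y = F y *m quat 0 (nu y).
    by rewrite -left_normalE mulKVmx // unitarymx_unit //; have [] := FSU2 y.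
  by rewrite FE quatM rpart_quat vpart_quat.
apply: eq_vsmooth (vsmoothD oU (vsmoothD oU (vsmoothZ oU sa sw)
  (vsmoothN oU (vsmoothZ oU sb su))) (vsmoothN oU (vsmooth_cross oU su sw))) => // y _.
by rewrite /left_normal invF {4}NE quatM vpart_quat scalerN crossNl.
Qed.

Lemma metric_left_frame k l y : U y ->
  metric_SU2 (F y) (pd_mx k F y) (pd_mx l F y) = dot (A k y) (A l y).
Proof.
by move=> Uy; rewrite /metric_SU2 !left_frameE // dot_su2_quat mulr0 subr0.
Qed.

(** The Maurer-Cartan equation: second derivatives cancel in the antisymmetric part of
    [dA], and [crossA] recognizes what is left. *)
Lemma left_moving_frame :
  (forall y, U y -> dot (A 0 y) (A 0 y) * dot (A 1 y) (A 1 y)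
     - dot (A 0 y) (A 1 y) * dot (A 0 y) (A 1 y) != 0) ->
  moving_frame U A nu.
Proof.
move=> gram.
have n1 y : dot (nu y) (nu y) = 1.
  by have := N_unit y; rewrite /metric_SU2 left_normalE dot_su2_quat mulr0 subr0.
have An k y : U y -> dot (A k y) (nu y) = 0.
  move=> Uy; have := N_orth k Uy.
  by rewrite /metric_SU2 left_normalE left_frameE // dot_su2_quat mulr0 subr0.
split => //.
- exact: smooth_left_frame.
- exact: smooth_left_normal.
- move=> y Uy; rewrite !dA // crossA // (pd_comm 0 1 oU sa Uy) (pdv_comm oU 0 1 Uy su).
  move: (crossC (pdv 1 u y) (pdv 0 u y)); clear.
  generalize (a y) (u y).
  repeat match goal with
  | |- context [cross ?v ?w] => generalize (cross v w)
  | |- context [pdv ?k ?f y] => generalize (pdv k f y)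
  | |- context [pd ?k ?f y] => generalize (pd k f y)
  end.
  move=> r0 r1 r2 v0 v1 v2 v3 v4 r3 v5 ->; move: (cross v5 v1) => v6.
  by apply: vecP; rewrite !mxE; ring.
- move=> y Uy; have := gram y Uy.
  rewrite (det_gram (n1 y) (An 0 y Uy) (An 1 y Uy)) mulf_eq0.
  by case/norP.
Qed.

(** The projection only removes a multiple of F, whose translate is real.  The
    translate of the second derivative of F is the derivative of the frame plus a cross
    product, and moving the derivative to the normal gives the pairing with [dnormal]. *)
Lemma second_form_left k l y : U y -> moving_frame U A nu ->
  metric_SU2 (F y) (proj_SU2 (F y) (pd_mx k (pd_mx l F) y)) (N y)
  = - dot (A k y) (dnormal A nu l y).
Proof.
move=> Uy fr.
have ddF : pd_mx k (pd_mx l F) y = quat (pd k (pd l a) y) (pdv k (pdv l u) y).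
  by rewrite -(pd_mx_quat k Uy (sP l) (sV l)); apply: eq_pd_mx => // z Uz; exact: pdF.
rewrite /metric_SU2 left_normalE /proj_SU2 ddF mulmxBr -scalemxAr.
rewrite mulVmx ?unitarymx_unit //; last by have [] := FSU2 y.
rewrite -quat_one quatZ quatN invF quatM quatD dot_su2_quat mulr0 subr0 scaler0.
rewrite oppr0 addr0 scalerN crossNl (dnormal_sym oU fr k l Uy).
have -> : a y *: pdv k (pdv l u) y - pd k (pd l a) y *: u y
    - cross (u y) (pdv k (pdv l u) y) = pdv k (A l) y + cross (A k y) (A l y).
  rewrite dA // crossA //; clear.
  generalize (a y) (u y).
  repeat match goal with
  | |- context [cross ?v ?w] => generalize (cross v w); intro
  | |- context [pdv ?k ?f y] => generalize (pdv k f y); intro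
  | |- context [pd ?k ?f y] => generalize (pd k f y); intro
  end.
  by move=> *; apply: vecP; rewrite !mxE; ring.
have K (v w z : vec) : dot (cross v w) z = - dot w (cross v z).
  by rewrite (dotC w) (dot_cross_cycle v z) (dot_cross_cycle z) crossC dotNl.
rewrite dotDl (dA_nu oU fr l k Uy) /dnormal dotDr opprD; congr (_ + _); exact: K.
Qed.

End SphereChart.

(** * Two-dimensional quadratic forms; charts *)

(** Complete the square: the vector (- h01, h00) is orthogonal to the first basis
    vector and takes the value h00 det h, of the sign opposite to h00.  If h00 = 0 the
    form is affine in the first coordinate along the line with second coordinate 1, and
    takes there the values 1 and -1, at two orthogonal vectors. *)
Lemma lorentz_basis (R : realType) (h : 'M[R]_2) : h 1 0 = h 0 1 -> \det h < 0 ->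
  exists2 B : 'M[R]_2, B \in unitmx &
    B *m h *m B^T = diag_mx (\row_k (-1) ^+ k).
Proof.
move=> sh; rewrite det22 sh => d0.
pose B0 (x y z w : R) : 'M[R]_2 :=
  \matrix_(i, j) if i == 0 then (if j == 0 then x else y) else (if j == 0 then z else w).
(* The rows of the basis are (x, y) and (z, w). *)
suff [x [y [z [w [e1 e2 e3]]]]] : exists x y z w : R,
    [/\ x * x * h 0 0 + 2 * x * y * h 0 1 + y * y * h 1 1 = 1,
        x * z * h 0 0 + (x * w + y * z) * h 0 1 + y * w * h 1 1 = 0 &
        z * z * h 0 0 + 2 * z * w * h 0 1 + w * w * h 1 1 = - 1].
  have E : B0 x y z w *m h *m (B0 x y z w)^T = diag_mx (\row_k (-1) ^+ k).
    apply/matrixP; apply: ord2P; apply: ord2P;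
      rewrite !mxE sum2 !mxE !sum2 !mxE /= sh ?expr0 ?expr1 ?mulr1n ?mulr0n.
    - by rewrite -e1; ring.
    - by rewrite -e2; ring.
    - by rewrite -e2; ring.
    - by rewrite -e3; ring.
  exists (B0 x y z w) => //; rewrite unitmxE unitfE.
  have := congr1 (fun X => \det X) E; rewrite /= !det_mulmx det_tr => e.
  apply/eqP => b0; move: e; rewrite b0 !mul0r (det22 (diag_mx _)) !mxE /=.
  rewrite expr0 expr1 ?mulr1n ?mulr0n => /eqP.
  by rewrite mul0r subr0 mul1r eq_sym oppr_eq0 oner_eq0.
move: d0; set a := h 0 0; set b := h 0 1; set c := h 1 1 => d0.
have sq (r : R) : 0 < r -> exists2 s, s != 0 & s * s = r.
  move=> r0; exists (Num.sqrt r); first by rewrite sqrtr_eq0 -ltNge.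
  by rewrite -expr2 sqr_sqrtr // ltW.
case: (ltgtP a 0) => [a0|a0|a0].
- have a0' : 0 < - a by rewrite oppr_gt0.
  have aD : 0 < a * (a * c - b * b) by rewrite nmulr_rgt0.
  have [r r0 rE] := sq _ a0'; have [s s0 sE] := sq _ aD.
  exists (- b / s), (a / s), r^-1, 0; split.
  + transitivity ((a * (a * c - b * b)) / (s * s)); first by field.
    by rewrite sE divff // -sE mulf_neq0.
  + by field; rewrite s0 r0.
  + transitivity (- (- a / (r * r))); first by field.
    by rewrite rE divff // -rE mulf_neq0.
- have [r r0 rE] := sq a a0.
  have aD : 0 < - (a * (a * c - b * b)) by rewrite oppr_gt0 pmulr_rlt0.
  have [s s0 sE] := sq _ aD.
  exists r^-1, 0, (- b / s), (a / s); split.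
  + transitivity (a / (r * r)); first by field.
    by rewrite rE divff // -rE mulf_neq0.
  + by field; rewrite s0 r0.
  + transitivity (- (- (a * (a * c - b * b)) / (s * s))); first by field.
    by rewrite sE divff // -sE mulf_neq0.
- have b0 : b != 0.
    by apply: contraTneq d0 => ->; rewrite a0 !mul0r subr0 ltxx.
  exists ((1 - c) / (2 * b)), 1, ((- 1 - c) / (2 * b)), 1.
  by rewrite a0; split; field.
Qed.

(** Evaluate the form at (- h01, h00), where it is h00 times the determinant. *)
Lemma posdef_det (R : realType) (h : 'M[R]_2) : h 1 0 = h 0 1 ->
  (forall v : 'rV[R]_2, v != 0 -> 0 < (v *m h *m v^T) 0 0) -> 0 < \det h.
Proof.
move=> sh hp; have q (a b : R) : (a != 0) || (b != 0) ->
    0 < a * a * h 0 0 + 2 * a * b * h 0 1 + b * b * h 1 1.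
  move=> ab; pose v : 'rV[R]_2 := \row_j if j == 0 then a else b.
  have v0 : v != 0.
    apply: contraTneq ab => v0; have := congr1 (fun w : 'rV[R]_2 => w 0 0) v0.
    have := congr1 (fun w : 'rV[R]_2 => w 0 1) v0.
    by rewrite !mxE /= => -> ->; rewrite !eqxx.
  have v00 : v 0 0 = a by rewrite mxE.
  have v01 : v 0 1 = b by rewrite mxE.
  have <- : (v *m h *m v^T) 0 0
      = a * a * h 0 0 + 2 * a * b * h 0 1 + b * b * h 1 1.
    rewrite mxE sum2 ![(v *m h) _ _]mxE !sum2 ![v^T _ _]mxE v00 v01 sh; ring.
  exact: hp.
have h00 : 0 < h 0 0.
  have -> : h 0 0 = 1 * 1 * h 0 0 + 2 * 1 * 0 * h 0 1 + 0 * 0 * h 1 1 by ring.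
  by apply: q; rewrite oner_eq0.
rewrite -(pmulr_rgt0 _ h00) det22 sh.
have -> : h 0 0 * (h 0 0 * h 1 1 - h 0 1 * h 0 1) = - h 0 1 * - h 0 1 * h 0 0
  + 2 * - h 0 1 * h 0 0 * h 0 1 + h 0 0 * h 0 0 * h 1 1 by ring.
by apply: q; rewrite (lt0r_neq0 h00) orbT.
Qed.

Section Surface.
Local Notation coord := Defs.coord.
Variables (R : realType) (M : surface R).
Implicit Types (i j : chart M) (p : M) (x : 'rV[R]_2).

Notation U i := (coord i @` dom i).

Lemma coord_dom i p : dom i p -> U i (coord i p).
Proof. by move=> ip; exists p. Qed.

Lemma paramK_dom i p : dom i p -> param i (coord i p) = p.
Proof. by move=> ip; apply: coordK; rewrite inE. Qed.

Lemma param_dom i x : U i x -> dom i (param i x) /\ coord i (param i x) = x.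
Proof. by move=> [p ip <-]; rewrite paramK_dom. Qed.

Lemma open_overlap i j : open (coord i @` (dom i `&` dom j)).
Proof.
rewrite openE => _ [p [ip jp] <-].
have pc : {for coord i p, continuous (param i)}.
  have := @param_continuous R M i; rewrite continuous_open_subspace; last exact: img_open.
  by apply; rewrite inE; exact: coord_dom.
have nj : nbhs (param i (coord i p)) (dom j).
  by rewrite paramK_dom //; apply: open_nbhs_nbhs; split => //; exact: dom_open.
have nU : nbhs (coord i p) (U i).
  by apply: open_nbhs_nbhs; split; [exact: img_open | exact: coord_dom].
have nn : nbhs (coord i p) (U i `&` param i @^-1` dom j).
  exact: filterI nU (pc _ nj).
by apply: filterS nn => x [Ux jx]; have [ix xE] := param_dom Ux; exists (param i x).
Qed.

(** A level set of a locally constant function is open, and so is its complement. *)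
Lemma locally_constant_connected (K : M -> R) : connected [set: M] ->
  (forall p, \forall q \near p, K q = K p) -> exists c, forall p, K p = c.
Proof.
move=> cM lc; have [p0|np] := pselect (exists p : M, True); last first.
  by exists 0 => p; case: np; exists p.
case: p0 => p0 _; exists (K p0) => p.
have oB (c : R) : open [set q | K q = c].
  rewrite openE => q /= Kq; have h : nbhs q [set r | K r = K q] := lc q.
  apply: filterS h => r /= ->.
  exact: Kq.
suff E : [set q | K q = K p0] = [set: M].
  by have : [set: M] p by []; rewrite -E.
apply: cM.
- by exists p0.
- by exists [set q | K q = K p0]; [exact: oB | rewrite setTI].
- exists [set q | K q = K p0]; last by rewrite setTI.
  rewrite -openC openE => q /= Kq; have h : nbhs q [set r | K r = K q] := lc q.
  by apply: filterS h => r Kr /= e; apply: Kq; rewrite -Kr.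
Qed.

End Surface.

(** * Change of charts for an immersion *)

#[local] Opaque left_frame.

Lemma comb2E (S : pzRingType) m n (c d : S) (X Y : 'M[S]_(m, n)) r s :
  (c *: X + d *: Y) r s = c * X r s + d * Y r s.
Proof. by rewrite !mxE. Qed.

Section ChainRule.
Local Open Scope complex_scope.
Variables (R : realType) (V : set 'rV[R]_2) (phi : 'rV[R]_2 -> 'rV[R]_2) (x : 'rV[R]_2).
Hypotheses (oV : open V) (Vx : V x) (dphi : differentiable phi x).
Implicit Types (h : 'rV[R]_2 -> R) (k : 'I_2).

Lemma pd_chain h h' k : differentiable h' (phi x) ->
  (forall y, V y -> h y = h' (phi y)) ->
  pd k h x = \sum_a jacobian phi x k a * pd a h' (phi x).
Proof.
move=> dh hE; rewrite (@eq_pd _ V k h (h' \o phi) x oV Vx hE).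
exact: pd_comp.
Qed.

Lemma pdv_chain (X X' : 'rV[R]_2 -> 'rV[R]_3) k :
  (forall r, differentiable (fun y => X' y 0 r : R) (phi x)) ->
  (forall y, V y -> X y = X' (phi y)) ->
  pdv k X x = \sum_a jacobian phi x k a *: pdv a X' (phi x).
Proof.
move=> dX XE; apply/rowP => r; rewrite pdvE.
have e := @pd_chain (fun y => X y 0 r) _ k (dX r) 
  (fun y Vy => congr1 (fun v : 'rV[R]_3 => v 0 r) (XE y Vy)).
rewrite {}e !sum2; move: (jacobian phi x k 0) (jacobian phi x k 1) => c d.
by rewrite comb2E !pdvE.
Qed.

Lemma pd_mx_chain (F F' : 'rV[R]_2 -> 'M[R[i]]_2) k :
  (forall r s, differentiable (fun y => complex.Re (F' y r s) : R) (phi x) /\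
     differentiable (fun y => complex.Im (F' y r s) : R) (phi x)) ->
  (forall y, V y -> F y = F' (phi y)) ->
  pd_mx k F x = \sum_a (jacobian phi x k a)%:C *: pd_mx a F' (phi x).
Proof.
move=> dF FE; apply/matrixP => r s; have [dr di] := dF r s.
have er := @pd_chain (fun y => complex.Re (F y r s)) _ k dr
  (fun y Vy => congr1 (fun X : 'M[R[i]]_2 => complex.Re (X r s)) (FE y Vy)).
have ei := @pd_chain (fun y => complex.Im (F y r s)) _ k di
  (fun y Vy => congr1 (fun X : 'M[R[i]]_2 => complex.Im (X r s)) (FE y Vy)).
rewrite mxE er ei !sum2; move: (jacobian phi x k 0) (jacobian phi x k 1) => c d.
rewrite comb2E ![pd_mx _ _ _ _ _]mxE.
have K (b b' z z' : R) : c * b + d * b' = (c * b - 0 * z) + (d * b' - 0 * z') /\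
    c * z + d * z' = (c * z + 0 * b) + (d * z' + 0 * b').
  by rewrite !mul0r !subr0 !addr0.
by apply: cplxP; rewrite !ReIm_simpl; [exact: (K _ _ _ _).1 | exact: (K _ _ _ _).2].
Qed.

End ChainRule.

Section Immersion.
Local Open Scope complex_scope.
Local Open Scope sesquilinear_scope.
Local Notation coord := Defs.coord.
Variables (R : realType) (M : surface R) (g : tensor2 M) (f n : M -> 'M[R[i]]_2).
Hypothesis g_riem : riemannian_metric g.
Hypothesis f_isom : isometric_immersion g f.
Hypothesis n_normal : unit_normal f n.
Implicit Types (i j : chart M) (p : M) (x y : 'rV[R]_2) (k l : 'I_2).

Notation U i := (coord i @` dom i).
Notation II := (second_form f n).
Notation G i := (fun y => g i (param i y)).

Definition chart_frame i := left_frame (f \o param i).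
Definition chart_normal i := left_normal (f \o param i) (n \o param i).

Notation A := chart_frame.
Notation nu := chart_normal.
Notation kappa i := (extrinsic_curvature (A i) (nu i)).

Let oU i : open (U i). Proof. exact: img_open. Qed.
Let sF i : smooth_mx_on (U i) (f \o param i).
Proof. by case: f_isom => + _ _; apply. Qed.
Let sN i : smooth_mx_on (U i) (n \o param i).
Proof. by case: n_normal => + _ _ _; apply. Qed.
Let fS i y : SU2 ((f \o param i) y). Proof. by case: f_isom => _ + _; apply. Qed.
Let nS i y : su2 (invmx ((f \o param i) y) *m (n \o param i) y).
Proof. by case: n_normal => _ + _ _; apply. Qed.
Let nU i y : metric_SU2 ((f \o param i) y) ((n \o param i) y) ((n \o param i) y) = 1.
Proof. by case: n_normal => _ _ + _; apply. Qed.
Let nO i k y : U i y ->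
  metric_SU2 ((f \o param i) y) (pd_mx k (f \o param i) y) ((n \o param i) y) = 0.
Proof.
move=> Uy; have [iy yE] := param_dom Uy; case: n_normal => _ _ _ /(_ i _ iy k).
by rewrite /d_mx yE.
Qed.

Lemma metric_gram i k l y : U i y -> G i y k l = dot (A i k y) (A i l y).
Proof.
move=> Uy; have [iy yE] := param_dom Uy; case: f_isom => _ _ /(_ i _ iy k l) <-.
rewrite /d_mx yE. exact (metric_left_frame (@oU i) (@sF i) (@fS i) k l Uy).
Qed.

Lemma metric_det_gt0 i p : dom i p -> 0 < \det (g i p).
Proof.
move=> ip; case: g_riem => -[_ gs _] /(_ i p ip); apply: posdef_det.
by have := congr1 (fun X : 'M[R]_2 => X 0 1) (gs i p ip); rewrite mxE.
Qed.

Lemma chart_moving_frame i : moving_frame (U i) (A i) (nu i).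
Proof.
apply: (left_moving_frame (@oU i) (@sF i) (@sN i) (@fS i) (@nS i) (@nU i)).
  by move=> k y; exact: nO.
move=> y Uy; have [iy _] := param_dom Uy.
have gm k l := @metric_gram i k l y Uy.
have <- : \det (g i (param i y)) = dot (A i 0 y) (A i 0 y) * dot (A i 1 y) (A i 1 y)
    - dot (A i 0 y) (A i 1 y) * dot (A i 0 y) (A i 1 y).
  rewrite det22; congr (_ * _ - _ * _); [exact: gm | exact: gm | exact: gm |].
  exact: etrans (gm 1 0) (dotC _ _).
by rewrite lt0r_neq0 // metric_det_gt0.
Qed.

Lemma second_form_chart i y : U i y ->
  II i (param i y) = second_fundamental (A i) (nu i) y.
Proof.
move=> Uy; have [iy yE] := param_dom Uy; apply/matrixP => k l.
rewrite [LHS]mxE [RHS]mxE /dd_mx yE.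
exact: (second_form_left (@oU i) (@sF i) (@fS i) (@nS i) k l Uy (chart_moving_frame i)).
Qed.

(** The Gauss curvature is defined with a particular chart around each point; the same
    formula in other charts has to wait for [curvature_transition]. *)
Lemma gauss_curvature_chart_at p :
  gauss_curvature g p = 1 + kappa (chart_at p) (coord (chart_at p) p).
Proof.
set i := chart_at p; have ip : dom i p by exact: dom_chart_at.
have Uy := coord_dom ip; have pE := paramK_dom ip.
have := gauss_equation (@oU i) (chart_moving_frame i) (@metric_gram i) Uy.
rewrite /= pE => e; rewrite /gauss_curvature -/i.
have d0 : \det (g i p) != 0 by rewrite lt0r_neq0 // metric_det_gt0.
by apply: (mulIf d0); rewrite divfK // -e.
Qed.

Section Transition.
Variables (i j : chart M) (p : M).
Hypotheses (ip : dom i p) (jp : dom j p).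
Let phi := coord j \o param i.
Let x := coord i p.
Let J := jacobian phi x.
Let V := coord i @` (dom i `&` dom j).

Let oV : open V. Proof. exact: open_overlap. Qed.
Let Vx : V x. Proof. by exists p. Qed.
Let phix : phi x = coord j p. Proof. by rewrite /phi /= paramK_dom. Qed.
Let dphi : differentiable phi x.
Proof. by have [d _] := @transition_smooth R M i j 1; exact: d. Qed.

Let V_param y : V y -> param i y = param j (phi y).
Proof. by move=> [q [iq jq] <-]; rewrite /phi /= paramK_dom // paramK_dom. Qed.

Lemma frame_transition k : A i k x = \sum_a J k a *: A j a (coord j p).
Proof.
have jx : U j (phi x) by rewrite phix; exact: coord_dom.
have fE : pd_mx k (f \o param i) x
    = \sum_a (J k a)%:C *: pd_mx a (f \o param j) (phi x).
  apply: (pd_mx_chain oV Vx dphi) => [r s|y Vy]; last by rewrite /= V_param.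
  have [sr si] := @sF j r s.
  by split; [exact: smooth_on_differentiable sr jx|exact: smooth_on_differentiable si jx].
have e := left_frameE (@oU i) (@sF i) (@fS i) k (coord_dom ip).
have ej a := left_frameE (@oU j) (@sF j) (@fS j) a jx.
have fxE : (f \o param j) (phi x) = (f \o param i) x by rewrite phix /= !paramK_dom.
move: e ej; rewrite -/x fE fxE phix !sum2; move: (J k 0) (J k 1) => c d e ej.
move: e; rewrite mulmxDr -!scalemxAr (ej 0) (ej 1).
by rewrite !quatZ quatD => /quat_inj[_ e]; exact: esym e.
Qed.

Lemma normal_transition : nu i x = nu j (coord j p).
Proof. by rewrite /nu /left_normal /= !paramK_dom. Qed.

Lemma dnormal_transition k : dnormal (A i) (nu i) k x
  = \sum_a J k a *: dnormal (A j) (nu j) a (coord j p).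
Proof.
have d : pdv k (nu i) x = \sum_a J k a *: pdv a (nu j) (coord j p).
  rewrite -phix; apply: (pdv_chain oV Vx dphi) => [r|y Vy].
    apply: smooth_on_differentiable (normal_smooth (chart_moving_frame j) r) _.
    by rewrite phix; exact: coord_dom.
  by rewrite /nu /left_normal /= V_param.
rewrite /dnormal {}d frame_transition normal_transition !sum2.
have K (c d : R) (v w v' w' z : 'rV[R]_3) : c *: v + d *: w + cross (c *: v' + d *: w') z
    = c *: (v + cross v' z) + d *: (w + cross w' z).
  by rewrite crossDl !crossZl !scalerDr addrACA.
exact: K.
Qed.

(** As minus the product of the frame with the derivatives of the normal, the second
    form involves first derivatives only, so the chain rule applies to each factor and
    no second derivative of the transition map appears. *)
Lemma second_form_transition : II i p = J *m II j p *m J^T.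
Proof.
have Ei := second_form_chart (coord_dom ip).
have Ej := second_form_chart (coord_dom jp).
rewrite paramK_dom // in Ei; rewrite paramK_dom // in Ej.
rewrite Ei Ej; apply/matrixP => k l.
have K (X Y : 'M[R]_2) : (X *m Y *m X^T) k l =
    (X k 0 * Y 0 0 + X k 1 * Y 1 0) * X l 0 + (X k 0 * Y 0 1 + X k 1 * Y 1 1) * X l 1.
  by rewrite mxE sum2 ![(X *m Y) _ _]mxE !sum2 ![X^T _ _]mxE.
have Z (c d c' d' : R) (v w v' w' : 'rV[R]_3) :
    - dot (c *: v + d *: w) (c' *: v' + d' *: w')
    = (c * - dot v v' + d * - dot w v') * c' + (c * - dot v w' + d * - dot w w') * d'.
  by rewrite !dotDl !dotDr !dotZl !dotZr; ring.
have S a b : second_fundamental (A j) (nu j) (coord j p) a b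
    = - dot (A j a (coord j p)) (dnormal (A j) (nu j) b (coord j p)) by rewrite mxE.
rewrite [LHS]mxE K (S 0 0) (S 0 1) (S 1 0) (S 1 1).
have -> := frame_transition k; have -> := dnormal_transition l.
by rewrite !sum2; exact: Z.
Qed.

End Transition.

End Immersion.

(** * Harmonicity and the curvature *)

Lemma sqr_eq_close (R : realType) (a b : R) :
  a * a = b * b -> `|b - a| < `|b| -> a = b.
Proof.
move=> /eqP; rewrite -subr_eq0.
have -> : a * a - b * b = (a - b) * (a + b) by ring.
rewrite mulf_eq0 subr_eq0 addr_eq0 => /orP[/eqP //|/eqP ->].
by rewrite opprK -mulr2n normrMn ltNge mulr2n lerDl normr_ge0.
Qed.

Lemma near_comp (R : realType) (T : topologicalType) (phi : T -> 'rV[R]_2) (p : T)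
    (P : 'rV[R]_2 -> Prop) : {for p, continuous phi} ->
  (\forall y \near phi p, P y) -> \forall q \near p, P (phi q).
Proof. by move=> c nP; exact: c. Qed.

Section HarmonicityAndCurvature.
Local Open Scope complex_scope.
Local Notation coord := Defs.coord.
Variables (R : realType) (M : surface R) (g : tensor2 M) (f n : M -> 'M[R[i]]_2).
Hypothesis g_riem : riemannian_metric g.
Hypothesis f_isom : isometric_immersion g f.
Hypothesis n_normal : unit_normal f n.
Implicit Types (i j : chart M) (p : M) (x y : 'rV[R]_2) (k l : 'I_2).

Notation U i := (coord i @` dom i).
Notation II := (second_form f n).
Notation A := (chart_frame f).
Notation nu := (chart_normal f n).
Notation kappa i := (extrinsic_curvature (A i) (nu i)).

Let oU i : open (U i). Proof. exact: img_open. Qed.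
Let fr i : moving_frame (U i) (A i) (nu i).
Proof. exact: chart_moving_frame g_riem f_isom n_normal i. Qed.

Let II_chart i p : dom i p -> II i p = second_fundamental (A i) (nu i) (coord i p).
Proof.
move=> ip; have := second_form_chart g_riem f_isom n_normal (coord_dom ip).
by rewrite paramK_dom.
Qed.

Lemma det_second_form i p : dom i p ->
  \det (II i p) = kappa i (coord i p) * \det (g i p).
Proof.
move=> ip; have Ux := coord_dom ip.
rewrite II_chart // (det_second_fundamental (@oU i) (fr i) Ux).
have := det_metric (fr i) (metric_gram f_isom (i := i)) Ux.
by rewrite paramK_dom // => ->.
Qed.

(** Both determinants are multiplied by the square of the Jacobian. *)
Lemma curvature_transition i j p : dom i p -> dom j p ->
  kappa i (coord i p) = kappa j (coord j p).
Proof.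
move=> ip jp; have d0 := lt0r_neq0 (metric_det_gt0 g_riem ip).
have gt : g i p = jacobian (coord j \o param i) (coord i p) *m g j p
    *m (jacobian (coord j \o param i) (coord i p))^T.
  by case: g_riem => -[_ _ gt] _; exact: gt.
apply: (mulIf d0); apply: etrans (esym (det_second_form ip)) _.
rewrite (second_form_transition g_riem f_isom n_normal ip jp) gt.
have K (a b c d : R) : a * (b * c) * d = b * (a * c * d) by ring.
rewrite !det_mulmx (det_second_form jp); exact: K.
Qed.

Lemma gauss_curvatureE i p : dom i p -> gauss_curvature g p = 1 + kappa i (coord i p).
Proof.
move=> ip; rewrite (gauss_curvature_chart_at g_riem f_isom n_normal).
by rewrite (curvature_transition (dom_chart_at p) ip).
Qed.

Lemma smooth_sym_second_form : smooth_sym_tensor II.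
Proof.
split=> [i k l | i p ip | i j p ip jp /=].
- have S := smooth_dot (@oU i) (frame_smooth (fr i) k) (smooth_dnormal (@oU i) (fr i) l).
  apply: eq_smooth_on (smooth_onN (@oU i) S) => // x Ux.
  by rewrite (second_form_chart g_riem f_isom n_normal Ux) mxE.
- rewrite (II_chart ip).
  have s := second_fundamental_sym (@oU i) (fr i) (coord_dom ip).
  apply/matrixP; apply: ord2P; apply: ord2P; rewrite [LHS]mxE;
    [exact: erefl | exact: s | exact: esym s | exact: erefl].
- exact: (second_form_transition g_riem f_isom n_normal ip jp).
Qed.

Lemma tension_quat (a : 'I_2 -> 'I_2 -> R) (c : 'I_2 -> 'I_2 -> 'I_2 -> R)
    (w : 'I_2 -> 'I_2 -> 'rV[R]_3) (v : 'I_2 -> 'rV[R]_3) (m : 'rV[R]_3) :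
  \sum_(k < 2) \sum_(l < 2) (a k l)%:C *:
    proj_S2 (quat 0 m) (quat 0 (w k l) - \sum_(r < 2) (c k l r)%:C *: quat 0 (v r))
  = quat 0 (\sum_(k < 2) \sum_(l < 2) a k l *:
      proj m (w k l - \sum_(r < 2) c k l r *: v r)).
Proof.
have e k l : (a k l)%:C *:
    proj_S2 (quat 0 m) (quat 0 (w k l) - \sum_(r < 2) (c k l r)%:C *: quat 0 (v r))
    = quat 0 (a k l *: proj m (w k l - \sum_(r < 2) c k l r *: v r)).
  rewrite !sum2 !quatZ quatD quatN quatD !mulr0 addr0 subr0.
  by rewrite proj_S2_quat quatZ mulr0.
have D (F : 'I_2 -> 'rV[R]_3) : \sum_(k < 2) quat 0 (F k) = quat 0 (\sum_(k < 2) F k).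
  by rewrite !sum2 quatD addr0.
rewrite -D; apply: eq_bigr => k _; rewrite -D; apply: eq_bigr => l _; exact: e.
Qed.

Lemma tension_chart (h : tensor2 M) i p : dom i p ->
  tension h (normal_gauss_map f n) i p
  = quat 0 (vtension (fun y => h i (param i y)) (nu i) (coord i p)).
Proof.
move=> ip; have Ux := coord_dom ip; set x := coord i p.
have sn := normal_smooth (fr i).
have z k y : pd k (fun=> 0 : R) y = 0 by exact: derive_cst.
have nE : normal_gauss_map f n \o param i = fun y => quat 0 (nu i y).
  apply/funext => y; have [_ nS _ _] := n_normal.
  exact: su2_quat (nS (param i y)).
have dE k y : U i y -> pd_mx k (normal_gauss_map f n \o param i) y
    = quat 0 (pdv k (nu i) y).
  by move=> Uy; rewrite nE (pd_mx_quat (@oU i) k Uy (smooth_on_cst _ 0) sn) z.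
have ddE k l : pd_mx k (pd_mx l (normal_gauss_map f n \o param i)) x
    = quat 0 (pdv k (pdv l (nu i)) x).
  rewrite (eq_pd_mx (@oU i) k Ux (fun y Uy => dE l y Uy)).
  by rewrite (pd_mx_quat (@oU i) k Ux (smooth_on_cst _ 0) (vsmooth_pdv l sn)) z.
have nx : normal_gauss_map f n p = quat 0 (nu i x).
  by have := congr1 (fun F => F x) nE; rewrite /= paramK_dom.
have hx : h i p = h i (param i x) by rewrite /x paramK_dom.
apply: etrans _ (tension_quat (fun k l => invmx (h i (param i x)) k l)
  (fun k l m => christ (fun y => h i (param i y)) k l m x)
  (fun k l => pdv k (pdv l (nu i)) x) (fun m => pdv m (nu i) x) (nu i x)).
apply: eq_bigr => k _; apply: eq_bigr => l _; rewrite hx nx.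
apply: (congr1 (fun w => _ *: proj_S2 _ w)).
apply: (f_equal2 (fun v w => v - w) (ddE k l)); apply: eq_bigr => m _.
exact: (congr1 (fun w => _ *: w) (dE m x Ux)).
Qed.

Hypothesis K_lt1 : forall p, gauss_curvature g p < 1.

Lemma kappa_lt0 i y : U i y -> kappa i y < 0.
Proof.
move=> Uy; have [iy yE] := param_dom Uy.
have := K_lt1 (param i y); rewrite (gauss_curvatureE iy) yE.
by rewrite -subr_gt0 opprD addrA subrr sub0r oppr_gt0.
Qed.

Let kappa0 i y : U i y -> kappa i y != 0.
Proof. by move=> Uy; rewrite lt_eqF // kappa_lt0. Qed.

Lemma second_form_lorentzian : lorentzian_metric II.
Proof.
split; first exact: smooth_sym_second_form.
move=> i p ip; apply: lorentz_basis; last first.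
  rewrite det_second_form // nmulr_rlt0 ?(metric_det_gt0 g_riem ip) //.
  by apply: kappa_lt0; exact: coord_dom.
have [_ s _] := smooth_sym_second_form.
by have := congr1 (fun X : 'M[R]_2 => X 0 1) (s i p ip); rewrite mxE.
Qed.

Lemma conformal_refl (h : tensor2 M) : conformal h h.
Proof.
exists (fun=> 1); first by move=> i; exact: smooth_on_cst.
by move=> p; split=> [|i ip]; rewrite ?ltr01 ?scale1r.
Qed.

(** Harmonicity for the second form itself gives K dK = 0, so that K^2 is locally
    constant.  Near a point the values of K then have one of two opposite signs, and
    continuity selects one of them. *)
Lemma harmonic_locally_constant : lorentz_harmonic II (normal_gauss_map f n) ->
  forall p, \forall q \near p, gauss_curvature g q = gauss_curvature g p.
Proof.
move=> harm p; pose i := chart_at p; have ip : dom i p by exact: dom_chart_at.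
have t0 y : U i y -> vtension (fun y => II i (param i y)) (nu i) y = 0.
  move=> Uy; have [iy yE] := param_dom Uy.
  have := harm II second_form_lorentzian (conformal_refl II) i _ iy.
  by rewrite (tension_chart _ iy) yE -quat_zero => /quat_inj[].
have HE y : U i y -> II i (param i y) = 1 *: second_fundamental (A i) (nu i) y.
  by move=> Uy; rewrite scale1r (second_form_chart g_riem f_isom n_normal Uy).
have dK l y : U i y -> pd l (kappa i) y * (1 + kappa i y) = 0.
  have one0 z : U i z -> (1 : R) != 0 by move=> _; exact: oner_neq0.
  move=> Uy; exact: (tension_eq0_curvature (@oU i) (fr i) (smooth_on_cst (U i) 1) one0 HE
    (@kappa0 i) Uy (t0 y Uy) l).
pose K (y : 'rV[R]_2) := 1 + kappa i y.
have sk := smooth_extrinsic_curvature (@oU i) (fr i).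
have sK : smooth_on (U i) K by apply: smooth_onD => //; exact: smooth_on_cst.
have sKK : smooth_on (U i) (fun y => K y * K y) by exact: smooth_onM.
have dKK l y : U i y -> pd l (fun y => K y * K y) y = 0.
  move=> Uy; have dk := smooth_on_derivable (v := delta_mx 0 l) sk Uy.
  have dKy := smooth_on_derivable (v := delta_mx 0 l) sK Uy.
  have e : pd l K y = pd l (kappa i) y.
    rewrite /K (pdD (derivable_cst _ _ _) dk).
    by rewrite [X in X + _ = _](derive_cst _ _ _) add0r.
  by rewrite (pdM dKy dKy) e (mulrC (K y)) dK // addr0.
have Ux := coord_dom ip.
have KK := pd0_locally_constant (@oU i) sKK Ux dKK.
have Kx : \forall y \near coord i p, K y = K (coord i p).
  have cK := smooth_on_continuous sK Ux.
  (* If K vanishes at p, constancy of its square suffices. *)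
  have [K0|K0] := eqVneq (K (coord i p)) 0.
    apply: filterS KK => y; rewrite K0 mul0r => /eqP.
    by rewrite mulf_eq0 orbb => /eqP.
  have K0' : 0 < `|K (coord i p)| by rewrite normr_gt0.
  have near1 : \forall y \near coord i p, `|K (coord i p) - K y| < `|K (coord i p)|.
    by move/cvgrPdist_lt: cK; apply.
  by apply: filterS2 KK near1 => y; exact: sqr_eq_close.
have cp : {for p, continuous (coord i)}.
  have := @Defs.coord_continuous R M i.
  rewrite continuous_open_subspace; last exact: dom_open.
  by apply; rewrite inE.
have n1 := near_comp cp Kx.
have n2 : nbhs p (dom i) by apply: open_nbhs_nbhs; split => //; exact: dom_open.
apply: filterS2 n1 n2 => q Kq iq.
rewrite (gauss_curvatureE iq) (gauss_curvatureE ip); exact: Kq.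
Qed.

(** Any admissible metric is a positive multiple of the second form, and the tension
    formula vanishes for all such multiples at once. *)
Lemma constant_curvature_harmonic c : (forall p, gauss_curvature g p = c) ->
  lorentz_harmonic II (normal_gauss_map f n).
Proof.
move=> Kc h _ [lam slam hE] i p ip; rewrite tension_chart //.
have Ux := coord_dom ip.
have kc y : U i y -> kappa i y = c - 1.
  move=> Uy; have [iy yE] := param_dom Uy.
  by rewrite -(Kc (param i y)) (gauss_curvatureE iy) yE addrC addKr.
have HE y : U i y -> h i (param i y)
    = (lam \o param i) y *: second_fundamental (A i) (nu i) y.
  move=> Uy; have [iy yE] := param_dom Uy.
  have [_ /(_ i iy) ->] := hE (param i y).
  by rewrite (second_form_chart g_riem f_isom n_normal Uy).
rewrite (curvature_tension_eq0 (@oU i) (fr i) (slam i) _ HE) //.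
- exact: quat_zero.
- by move=> y Uy; have [l0 _] := hE (param i y); rewrite /= lt0r_neq0.
- exact: kappa0.
- move=> l; rewrite (@eq_pd _ (U i) l _ (fun=> c - 1) _ (@oU i) Ux kc).
  exact: derive_cst.
Qed.

End HarmonicityAndCurvature.

Theorem theorem3p1 (R : realType) (M : surface R) (g : tensor2 M)
    (f n : M -> 'M[R[i]]_2)
    (M_connected : connected [set: M])
    (g_riemannian : riemannian_metric g)
    (f_isometric : isometric_immersion g f)
    (n_unit_normal : unit_normal f n)
    (K_lt1 : forall p : M, gauss_curvature g p < 1) :
  lorentz_harmonic (second_form f n) (normal_gauss_map f n) <->
  exists c : R, forall p : M, gauss_curvature g p = c.
Proof.
split=> [harm|[c Kc]].
  apply: locally_constant_connected M_connected _ => p.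
  exact: (harmonic_locally_constant g_riemannian f_isometric n_unit_normal K_lt1 harm).
exact: (constant_curvature_harmonic g_riemannian f_isometric n_unit_normal K_lt1 Kc).
Qed.
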